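(* Let $\ell\ge 2$ and let $\mathbf G(\mathfrak o_\ell)$ be either ${\rm GL}_n(\mathfrak o_\ell)$ (any $p$) or ${\rm SL}_n(\mathfrak o_\ell)$ with $p$ odd and $p\nmid n$. Then: (1) an irreducible representation of $\mathbf G(\mathfrak o_\ell)$ admits a $\theta$-Whittaker model for some non-degenerate character $\theta$ of $\mathbf U(\mathfrak o_\ell)$ if and only if it is regular; (2) for every non-degenerate character $\theta$ of $\mathbf U(\mathfrak o_\ell)$, every irreducible representation of $\mathbf G(\mathfrak o_\ell)$ admits at most one $\theta$-Whittaker model.
   Context: Let $\mathbf F$ be a non-archimedean local field with ring of integers $\mathfrak o$, maximal ideal $\mathfrak p=\varpi\mathfrak o$, residue field $\mathbf k\cong\mathbb F_q$ of characteristic $p$; $\mathfrak o_r=\mathfrak o/\mathfrak p^r$. $\mathbf U(\mathfrak o_\ell)$ is the group of upper triangular unipotent matrices in $\mathbf G(\mathfrak o_\ell)$. A character $\varphi$ of $(\mathfrak o_\ell,+)$ is primitive if it is nontrivial on $\varpi^{\ell-1}\mathfrak o_\ell$; a non-degenerate character of $\mathbf U(\mathfrak o_\ell)$ is $\theta((u_{ij}))=\prod_{i=1}^{n-1}\varphi_i(u_{i,i+1})$ with all $\varphi_i$ primitive. An irreducible representation $\pi$ of $\mathbf G(\mathfrak o_\ell)$ admits a $\theta$-Whittaker model if $\mathrm{Hom}_{\mathbf G(\mathfrak o_\ell)}(\pi,\mathrm{Ind}_{\mathbf U(\mathfrak o_\ell)}^{\mathbf G(\mathfrak o_\ell)}\theta)\neq0$,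 and admits at most one if this space has dimension $\le1$. Regular representations: let $\mathfrak g=M_n$ if $\mathbf G={\rm GL}_n$ and $\mathfrak g=\mathfrak{sl}_n$ (trace-zero matrices) if $\mathbf G={\rm SL}_n$. For $1\le i<\ell$ let $K_\ell^i=\ker(\mathbf G(\mathfrak o_\ell)\to\mathbf G(\mathfrak o_i))$. Fix a primitive character $\varphi$ of $\mathfrak o_\ell$. For $i\ge\ell/2$ the group $K_\ell^i=\{I+\varpi^i y\}$ is abelian, and each $x\in\mathfrak g(\mathfrak o_{\ell-i})$ gives a character $\varphi_x$ of $K_\ell^i$, $\varphi_x(I+\varpi^i y)=\varphi(\varpi^i\,\mathrm{tr}(\hat x y))$, with $\hat x$ any lift of $x$ to $\mathfrak g(\mathfrak o_\ell)$. An element $x\in\mathfrak g(\mathfrak o_r)$ is regular if there is $v\in\mathfrak o_r^{\oplus n}$ such that $v,xv,\dots,x^{n-1}v$ is a basis of $\mathfrak o_r^{\oplus n}$ (for $r=1$: the characteristic polynomial equals the minimal polynomial). An irreducible representation $\rho$ of $\mathbf G(\mathfrak o_\ell)$ is regular if its restriction to $K_\ell^{\ell-1}$ contains $\varphi_x$ for some regular $x\in\mathfrak g(\mathbb F_q)$. *)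

(* Defs.v *)
From HB Require Import structures.
From mathcomp Require Import all_boot all_order all_algebra all_fingroup all_solvable all_field all_character.
Set Implicit Arguments.
Unset Strict Implicit.
Unset Printing Implicit Defensive.
Import Order.TTheory GRing.Theory Num.Theory.
Local Open Scope ring_scope.

(* [oell R l w] : R is (isomorphic to) O / varpi^l O, where O is a discrete
   valuation ring (equivalently, up to completion, the ring of integers of a
   non-archimedean local field: the residue field O/varpi = R/wR is finite
   because R is finite), and w is the image of the uniformizer varpi.
   Every nonzero element of O is a unit times a power of varpi. *)
Definition oell (R : finComUnitRingType) (l : nat) (w : R) : Prop :=
  exists (O : idomainType) (varpi : O) (f : {rmorphism O -> R}),
    [/\ varpi != 0 /\ varpi \notin GRing.unit,
        (forall x : O, x != 0 ->
           exists (u : O) (k : nat), u \is a GRing.unit /\ x = u * varpi ^+ k),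
        (forall y : R, exists x : O, f x = y),
        (forall x : O, f x = 0 <-> exists c : O, x = c * varpi ^+ l)
      & f varpi = w].

(* p is the characteristic of the residue field k = R / wR (R local). *)
Definition resid_char (R : finComUnitRingType) (p : nat) : Prop :=
  prime p /\ (p%:R : R) \notin GRing.unit.

Definition additive_char (R : finComUnitRingType) (phi : R -> algC) : Prop :=
  phi 0 = 1 /\ forall a b : R, phi (a + b) = phi a * phi b.

Definition primitive_addchar (R : finComUnitRingType) (l : nat) (w : R)
    (phi : R -> algC) : Prop :=
  exists a : R, phi (w ^+ l.-1 * a) != 1.

Section Groups.
Variables (n : nat) (R : finComUnitRingType).

Definition SLset : {set {'GL_n[R]}} := [set g | \det (GLval g) == 1].

Fact SL_group_set : group_set SLset.
Proof.
apply/group_setP; split=> [|x y]; rewrite !inE ?GL_1E ?det1 //.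
by move=> /eqP dx /eqP dy; rewrite GL_MxE det_mulmx dx dy mulr1.
Qed.
Canonical SL_group := group SL_group_set.

Definition Ggrp (isSL : bool) : {group {'GL_n[R]}} :=
  if isSL then SL_group else GLgroup_group n R.

Definition unitri (A : 'M[R]_n.-1.+1) : bool :=
  [forall i : 'I_n.-1.+1, forall j : 'I_n.-1.+1, ((j < i)%N ==> (A i j == 0)) && ((i == j) ==> (A i j == 1))].

Definition Uset : {set {'GL_n[R]}} := [set g | unitri (GLval g)].

Fact U_group_set : group_set Uset.
Proof.
apply/group_setP; split=> [|x y]; rewrite !inE.
  apply/forallP=> i; apply/forallP=> j; rewrite GL_1E !mxE.
  by case: (eqVneq i j) => [->|ne]; rewrite ?ltnn ?eqxx ?implybT.
move=> /forallP hx /forallP hy; apply/forallP=> i; apply/forallP=> j.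
have Hx i' j' := andP (forallP (hx i') j').
have Hy i' j' := andP (forallP (hy i') j').
rewrite GL_MxE !mxE; apply/andP; split; apply/implyP=> hij.
  rewrite big1 // => k _.
  case: (ltnP k i) => hki; first by rewrite (eqP (implyP (Hx i k).1 hki)) mul0r.
  by rewrite (eqP (implyP (Hy k j).1 (leq_trans hij hki))) mulr0.
rewrite (eqP hij) (bigD1 j) //= (eqP (implyP (Hx j j).2 (eqxx _))).
rewrite (eqP (implyP (Hy j j).2 (eqxx _))) mulr1 big1 ?addr0 // => k hk.
case: (ltnP k j) => hkj; first by rewrite (eqP (implyP (Hx j k).1 hkj)) mul0r.
have : (j < k)%N by rewrite ltn_neqAle hkj andbT; apply: contra hk => /eqP/val_inj ->.
by move=> h; rewrite (eqP (implyP (Hy k j).1 h)) mulr0.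
Qed.
Canonical U_group := group U_group_set.

(* the principal congruence subgroup ker(GL_n(o_l) -> GL_n(o_i)), i.e.
   {I + w^i y}, intersected with G(o_l) *)
Definition Kset (w : R) (i : nat) : {set {'GL_n[R]}} :=
  [set g | [exists y : 'M[R]_n.-1.+1, GLval g == 1 + w ^+ i *: y]].

Fact K_group_set w i : group_set (Kset w i).
Proof.
apply/group_setP; split=> [|x y]; rewrite !inE.
  by apply/existsP; exists 0; rewrite scaler0 addr0 GL_1E.
move=> /existsP[a /eqP ha] /existsP[b /eqP hb]; apply/existsP.
exists (a + b + (w ^+ i *: a) * b).
rewrite GL_ME ha hb mulrDl !mulrDr !mul1r !mulr1 !scalerDr.
by rewrite -scalerAr !addrA -(addrA 1 (w ^+ i *: b)) (addrC (w ^+ i *: b)) addrA.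
Qed.
Canonical K_group w i := group (K_group_set w i).

Definition Kgrp (isSL : bool) (w : R) (i : nat) : {group {'GL_n[R]}} :=
  (Ggrp isSL :&: K_group w i)%G.

Definition krylov (x : 'M[R]_n.-1.+1) (v : 'cV[R]_n.-1.+1) : 'M[R]_n.-1.+1 :=
  \matrix_(i, j) (x ^+ j *m v) i 0.

Definition regular_elt (x : 'M[R]_n.-1.+1) : Prop :=
  exists v : 'cV[R]_n.-1.+1, krylov x v \in unitmx.

End Groups.

Definition nondeg_char (n : nat) (R : finComUnitRingType) (l : nat) (w : R)
    (theta : 'CF(U_group n R)) : Prop :=
  exists phis : 'I_n.-1 -> R -> algC,
    (forall i, additive_char (phis i) /\ primitive_addchar l w (phis i)) /\
    forall u : {'GL_n[R]}, u \in U_group n R ->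
      theta u = \prod_(i < n.-1) phis i (GLval u (inord i) (inord i.+1)).

Definition whittaker (n : nat) (R : finComUnitRingType) (isSL : bool)
    (i : Iirr (Ggrp n R isSL)) (theta : 'CF(U_group n R)) : Prop :=
  '['chi_i, 'Ind[Ggrp n R isSL] theta] != 0.

Definition phi_x (n : nat) (R : finComUnitRingType) (isSL : bool) (l : nat)
    (w : R) (phi : R -> algC) (x : 'M[R]_n.-1.+1)
    (psi : 'CF(Kgrp n isSL w l.-1)) : Prop :=
  forall (g : {'GL_n[R]}) (y : 'M[R]_n.-1.+1), g \in Kgrp n isSL w l.-1 ->
    GLval g = 1 + w ^+ l.-1 *: y -> psi g = phi (w ^+ l.-1 * \tr (x * y)).

(* regular representation: Res to K_l^{l-1} contains phi_x for some regular x
   in g(k); x is given through a lift xh in g(o_l) (traceless for SL). *)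
Definition regular_irr (n : nat) (R : finComUnitRingType) (isSL : bool)
    (l : nat) (w : R) (phi : R -> algC) (i : Iirr (Ggrp n R isSL)) : Prop :=
  exists xh : 'M[R]_n.-1.+1,
    [/\ isSL -> \tr xh = 0, regular_elt xh &
     exists psi : 'CF(Kgrp n isSL w l.-1),
       phi_x phi xh psi /\ '['Res[Kgrp n isSL w l.-1] 'chi_i, psi] != 0].

(* Main.v *)
Require Import Defs.
From HB Require Import structures.
From mathcomp Require Import all_boot all_order all_algebra all_fingroup all_solvable all_field all_character.
From mathcomp Require Import ring zify.
Import Order.TTheory GRing.Theory Num.Theory.
Local Open Scope ring_scope.

(* Write l = a + b with a = l/2 rounded down. An irreducible representation
   decomposes under the abelian group 1 + w^b M into characters phi_x, with x a
   matrix modulo w^a. On U a non-degenerate theta is u |-> phi (tr (x (u - 1)))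
   for a Hessenberg x with unit subdiagonal, so a theta-Whittaker vector has
   nonzero components only at Hessenberg, hence regular, x. Two such x in the
   same representation are conjugate, and the change of Krylov basis is a
   conjugation by U; therefore a Whittaker vector is determined by its component
   at a single x, with idempotent e.
   By Schur's lemma the corner e rho(G) e is irreducible. It comes from the
   stabilizer of x, the polynomials in x times 1 + w^a M. If g is such a
   polynomial, replacing x by some x + w^a t makes the central character omega
   trivial on all commutators [g, k] lying in the radical, k in 1 + w^a M; then
   the average of the conjugates of g^-1 under 1 + w^a M is a nonzero scalar, and
   e rho(g) lies in the span of e rho(1 + w^a M). So the corner is the Heisenberg
   representation of 1 + w^a M, and the subgroup (U \cap (1 + w^a M)) * radical
   is a polarization of it: it has exactly one line with the character theta.
   Averaging that line over U gives a Whittaker vector for every regular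
   representation. For SL_n, rho is first extended to the matrices with
   determinant in 1 + w R. *)

Set Implicit Arguments.
Unset Strict Implicit.
Unset Printing Implicit Defensive.


(** For additive identities between matrices: products and scalings become atoms, and the rest is
    checked entrywise. *)
Ltac mx_zmod :=
  repeat match goal with
  | |- context [@GRing.mul ?T ?a ?b] =>
      move: (@GRing.mul T a b) => ?
  | |- context [@GRing.scale ?T ?V ?a ?b] =>
      move: (@GRing.scale T V a b) => ?
  end;
  apply/matrixP=> ? ?; rewrite !mxE; ring.

(* The intended values are [a = l./2] and [b = l - a]; the proofs for even and
   odd [l] are the same. *)
Record setting (R : finComUnitRingType) (l a b : nat) (w : R)
    (phi : R -> algC) : Prop := Setting {
  l_split : l = (a + b)%N;
  a_gt0 : (0 < a)%N;
  le_a_b : (a <= b)%N;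
  le_b_2a : (b <= a.*2)%N;
  w_l : w ^+ l = 0;
  w_ann : forall i r, (i <= l)%N -> w ^+ (l - i) * r = 0 ->
    exists s, r = w ^+ i * s;
  w_nunit : w \notin GRing.unit;
  nunit_w : forall r, r \notin GRing.unit -> exists s, r = w * s;
  phi_0 : phi 0 = 1;
  phi_D : forall r s, phi (r + s) = phi r * phi s;
  phi_nondeg : forall r, (forall s, phi (r * s) = 1) -> r = 0 }.

(** * The filtration of the matrix ring by powers of [w], and its duality under [phi] *)

Section Levels.
Variables (R : finComUnitRingType) (l a b : nat) (w : R) (phi : R -> algC).
Hypothesis S : setting l a b w phi.
Variable m : nat.
Local Notation M := 'M[R]_m.+1.

(* [level i] is the ideal [w^i M], written as an annihilator so that it is a
   boolean condition. *)
Definition level (i : nat) (A : M) : bool := w ^+ (l - i) *: A == 0.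

Lemma level0 i : level i 0.
Proof. by rewrite /level scaler0. Qed.

Lemma levelD i A B : level i A -> level i B -> level i (A + B).
Proof. by rewrite /level scalerDr => /eqP-> /eqP->; rewrite addr0. Qed.

Lemma levelN i A : level i (- A) = level i A.
Proof. by rewrite /level scalerN oppr_eq0. Qed.

Lemma levelB i A B : level i A -> level i B -> level i (A - B).
Proof. by move=> hA hB; rewrite levelD ?levelN. Qed.

Lemma levelBC i A B : level i (A - B) = level i (B - A).
Proof. by rewrite -levelN opprB. Qed.

Lemma levelDr i A B : level i B -> level i (A + B) = level i A.
Proof.
move=> hB; apply/idP/idP => [h|h]; last exact: levelD.
by rewrite -(addrK B A); apply: levelB.
Qed.

Lemma levelMr i A B : level i A -> level i (A * B).
Proof. by rewrite /level scalerAl => /eqP->; rewrite mul0r. Qed.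

Lemma levelMl i A B : level i B -> level i (A * B).
Proof. by rewrite /level scalerAr => /eqP->; rewrite mulr0. Qed.

Lemma levelZ i c A : level i A -> level i (c *: A).
Proof. by rewrite /level scalerA mulrC -scalerA => /eqP->; rewrite scaler0. Qed.

Lemma level_le i j A : (i <= j)%N -> level j A -> level i A.
Proof.
move=> le_ij; rewrite /level => /eqP h.
(* The truncated subtractions make this hold for [j > l] too, where [level j A] says [A = 0]. *)
have -> : (l - i = (j - i - (j - l)) + (l - j))%N by lia.
by rewrite exprD -scalerA h scaler0.
Qed.

Lemma level_sum (I : Type) (r : seq I) (P : pred I) i (F : I -> M) :
  (forall k, P k -> level i (F k)) -> level i (\sum_(k <- r | P k) F k).
Proof. by move=> h; elim/big_ind: _ => //; [exact: level0 | exact: levelD]. Qed.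

Lemma w_ge i : (l <= i)%N -> w ^+ i = 0.
Proof. by move=> h; rewrite -(subnK h) exprD (w_l S) mulr0. Qed.

Lemma level_w i A : level i (w ^+ i *: A).
Proof. by rewrite /level scalerA -exprD w_ge ?scale0r //; lia. Qed.

Lemma levelP i A : (i <= l)%N -> level i A -> exists B, A = w ^+ i *: B.
Proof.
move=> le_il /eqP/matrixP h.
have hx (j k : 'I_m.+1) : exists s, A j k == w ^+ i * s.
  by have := h j k; rewrite !mxE => /(w_ann S le_il)[s ->]; exists s.
exists (\matrix_(j, k) xchoose (hx j k)).
by apply/matrixP => j k; rewrite !mxE; apply/eqP/(xchooseP (hx j k)).
Qed.

Lemma level_eq0 i A : (l <= i)%N -> level i A -> A = 0.
Proof.
move=> h; rewrite /level (_ : l - i = 0)%N; last by lia.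
by rewrite expr0 scale1r => /eqP.
Qed.

Lemma levelM i j A B : level i A -> level j B -> level (i + j) (A * B).
Proof.
move=> hA hB; have [le_il|/ltnW/level_eq0/(_ hA)->] := leqP i l; last first.
  by rewrite mul0r level0.
have [le_jl|/ltnW/level_eq0/(_ hB)->] := leqP j l; last first.
  by rewrite mulr0 level0.
have [C ->] := levelP le_il hA; have [D ->] := levelP le_jl hB.
by rewrite -scalerAl -scalerAr scalerA -exprD level_w.
Qed.

Lemma levelM0 i j A B : (l <= i + j)%N -> level i A -> level j B -> A * B = 0.
Proof. by move=> h hA hB; apply: level_eq0 h (levelM hA hB). Qed.

Lemma levelX k A : level 1 A -> level k (A ^+ k).
Proof.
move=> hA; elim: k => [|k IHk]; last by rewrite exprS -add1n; apply: levelM.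
by rewrite /level subn0 (w_l S) scale0r.
Qed.

(** [A] is nilpotent, so a geometric series in [- A] inverts [1 + A]; it is read off the
    factorization of [(- A) ^+ l - 1]. *)
Lemma level1_unit A : level 1 A -> 1 + A \is a GRing.unit.
Proof.
move=> hA; have nil : (- A) ^+ l = 0.
  by apply: (@level_eq0 l) => //; apply: levelX; rewrite levelN.
have := subrXX_comm l (commr1 (- A)); rewrite nil expr1n sub0r => e.
have e2 : (1 + A) *m (\sum_(i < l) (- A) ^+ (l.-1 - i) * 1 ^+ i) = 1%:M.
  by apply: oppr_inj; rewrite [RHS]e mulmxE -mulNr opprD addrC.
by case: (mulmx1_unit e2).
Qed.

Lemma unit_level1 A B : level 1 (A - B) -> A \is a GRing.unit ->
  B \is a GRing.unit.
Proof.
move=> hAB uA; have -> : B = A * (1 + A^-1 * (B - A)).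
  by rewrite mulrDr mulr1 mulVKr // addrC subrK.
by rewrite unitrMr // level1_unit // levelMl // levelBC.
Qed.

Lemma level1_inv k A B : A \is a GRing.unit -> B \is a GRing.unit ->
  level k (A - B) -> level k (A^-1 - B^-1).
Proof.
move=> uA uB h; have -> : A^-1 - B^-1 = A^-1 * (B - A) * B^-1.
  by rewrite mulrBr mulrBl mulVr // mul1r mulrK.
by rewrite levelMr // levelMl // levelBC.
Qed.

Lemma level_eqP k A : (k <= l)%N ->
  reflect (w ^+ k *: A = 0) (level (l - k) A).
Proof. by move=> h; rewrite /level subKn //; apply: eqP. Qed.

Lemma mxtraceC (A B : M) : \tr (A * B) = \tr (B * A).
Proof. exact: mxtrace_mulC. Qed.

Lemma phi_N r : phi (- r) = (phi r)^-1.
Proof.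
have h : phi (- r) * phi r = 1 by rewrite -(phi_D S) addNr (phi_0 S).
have nz : phi r != 0.
  by apply/eqP=> z; move: h; rewrite z mulr0 => /eqP; rewrite eq_sym oner_eq0.
by rewrite -[LHS](mulfK nz) h mul1r.
Qed.

Lemma phi_neq0 r : phi r != 0.
Proof.
apply/eqP=> z; have := phi_D S r (- r).
by rewrite subrr (phi_0 S) z mul0r => /eqP; rewrite oner_eq0.
Qed.

(** The additive group of [R] is finite, so [phi r] is a root of unity and its conjugate is its
    inverse. *)
Lemma phi_conj r : (phi r)^* = phi (- r).
Proof.
have hX k : phi (r *+ k) = phi r ^+ k.
  by elim: k => [|k IHk]; rewrite ?mulr0n ?(phi_0 S) // mulrS (phi_D S) IHk exprS.
have h : phi r ^+ #|R| = 1.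
  rewrite -hX; have -> : r *+ #|R| = 0; last exact: phi_0 S.
  by rewrite -FinRing.zmodXgE -cardsT expg_cardG ?inE.
have c0 : (0 < #|R|)%N by apply/card_gt0P; exists 0.
have n1 : `|phi r| = 1.
  by apply/eqP; rewrite -(pexpr_eq1 c0) ?normr_ge0 // -normrX h normr1.
by rewrite phi_N invC_norm n1 expr1n invr1 mul1r.
Qed.

Lemma mxtrace_delta (A : M) (i j : 'I_m.+1) : \tr (A * delta_mx j i) = A i j.
Proof.
rewrite /mxtrace (bigD1 i) //= big1 => [|k /negPf ne].
  rewrite addr0 mxE (bigD1 j) //= big1 => [|k /negPf ne].
    by rewrite !mxE !eqxx addr0 mulr1.
  by rewrite !mxE ne mulr0.
by rewrite mxE big1 // => k' _; rewrite !mxE ne andbF mulr0.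
Qed.

Lemma phi_mx_nondeg (A : M) : (forall B, phi (\tr (A * B)) = 1) -> A = 0.
Proof.
move=> h; apply/matrixP => i j; rewrite mxE; apply: (phi_nondeg S) => s.
by rewrite -{}(h (s *: delta_mx j i)) -scalerAr mxtraceZ mxtrace_delta mulrC.
Qed.

(** Translation by [B] multiplies the sum by [F B]. Only this translation has to respect [P] and
    [F], which lets [P] be a mere predicate. *)
Lemma sum_char_eq0 (V : finZmodType) (P : pred V) (F : V -> algC) B :
  (forall A, P (A + B) = P A) ->
  (forall A, P A -> F (A + B) = F A * F B) ->
  F B != 1 -> \sum_(A | P A) F A = 0.
Proof.
move=> hP hF nB; apply/eqP; set s := bigop _ _ _.
have : s = s * F B.
  rewrite {1}/s (reindex (fun A => A + B)) /=; last first.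
    by exists (fun A => A - B) => A _; rewrite ?addrK ?subrK.
  by rewrite mulr_suml; apply: eq_big => [A|A hA]; [rewrite hP | rewrite hF // -hP].
move/eqP; rewrite -subr_eq0 -{1}[s]mulr1 -mulrBr mulf_eq0 subr_eq0.
by case/orP=> //; rewrite eq_sym (negPf nB).
Qed.

Lemma sum_phi_tr A :
  \sum_(B : M) phi (\tr (A * B)) = if A == 0 then #|{: M}|%:R else 0.
Proof.
case: eqP => [->|nz].
  rewrite (eq_bigr (fun=> 1)) ?sumr_const // => B _.
  by rewrite mul0r mxtrace0 (phi_0 S).
suff /existsP[B hB] : [exists B : M, phi (\tr (A * B)) != 1].
  by apply: (@sum_char_eq0 _ _ _ B) => // C; rewrite mulrDr mxtraceD (phi_D S).
apply/existsPn => h; apply: nz; apply: phi_mx_nondeg => B.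
by apply/eqP; have := h B; rewrite negbK.
Qed.

(** Testing [A] on [w ^+ i *: B] for all [B] gives [w ^+ i *: A = 0]; so the annihilator of [w^i M]
    in the trace pairing is [w^(l - i) M]. *)
Lemma levelMw i A : (i <= l)%N -> (forall B, level i B -> phi (\tr (A * B)) = 1) ->
  level (l - i) A.
Proof.
move=> h hB; apply/level_eqP => //; apply: phi_mx_nondeg => B.
by rewrite -scalerAl scalerAr hB // level_w.
Qed.

Lemma sum_phi_level i A : (i <= l)%N ->
  \sum_(B | level i B) phi (\tr (A * B)) =
    if level (l - i) A then #|[pred B | level i B]|%:R else 0.
Proof.
move=> h; case: ifPn => [hA|nA].
  rewrite (eq_bigr (fun=> 1)) ?sumr_const // => B hB.
  by rewrite (@levelM0 (l - i) i) ?mxtrace0 ?(phi_0 S) //; lia.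
suff /existsP[B /andP[hB nB]] : [exists B, level i B && (phi (\tr (A * B)) != 1)].
  apply: (@sum_char_eq0 _ _ _ B) => // C; last by rewrite mulrDr mxtraceD (phi_D S).
  exact: levelDr.
apply/existsPn => nB; case/negP: nA; apply: levelMw => // B hB.
by apply/eqP; have := nB B; rewrite hB negbK.
Qed.

End Levels.


(** * Cyclic vectors and centralizers of regular matrices *)

Section Krylov.
Variables (R : finComUnitRingType) (l a b : nat) (w : R) (phi : R -> algC).
Hypothesis S : setting l a b w phi.
Variable m : nat.
Local Notation M := 'M[R]_m.+1.
Local Notation level := (@level R l w m).
Local Notation kr := (@krylov m.+1 R).
Implicit Types (x y g : M) (v c : 'cV[R]_m.+1).

(** The coefficients form a column, so that applying the polynomial to [v] is a product with the
    Krylov matrix. *)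
Definition polm x c : M := \sum_(j < m.+1) c j 0 *: x ^+ j.

Lemma krylov_mul x v c : kr x v *m c = polm x c *m v.
Proof.
rewrite /polm mulmx_suml; apply/matrixP => i j; rewrite !mxE summxE.
by apply: eq_bigr => k _; rewrite -scalemxAl !mxE ord1 mulrC.
Qed.

Lemma polm_comm x y c : y * x = x * y -> y * polm x c = polm x c * y.
Proof.
move=> h; apply: commr_sum => j _; rewrite /GRing.comm -scalerAl -scalerAr.
by congr (_ *: _); apply: commrX.
Qed.

Lemma polm_cyclic x v y : kr x v \in unitmx ->
  polm x (invmx (kr x v) *m (y *m v)) *m v = y *m v.
Proof. by move=> u; rewrite -krylov_mul mulKVmx. Qed.

Lemma krylov_eq0 x v y : kr x v \in unitmx ->
  (forall j : 'I_m.+1, y *m (x ^+ j *m v) = 0) -> y = 0.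
Proof.
move=> u h; rewrite -[y](mulmxK u) -[RHS](mul0mx _ (invmx (kr x v))).
congr (_ *m _); apply/matrixP => i j; have /matrixP/(_ i 0) := h j.
by rewrite !mxE => e; rewrite -[RHS]e; apply: eq_bigr => k _; rewrite !mxE.
Qed.

Lemma krylov_comm_eq0 x v y : kr x v \in unitmx -> y * x = x * y ->
  y *m v = 0 -> y = 0.
Proof.
move=> u h hv; apply: (krylov_eq0 u) => j.
by rewrite mulmxA mulmxE (commrX j h) -mulmxE -mulmxA hv mulmx0.
Qed.

(** Subtract from [y] the polynomial in [x] that agrees with it at [v]. After scaling by
    [w ^+ (l - i)] the difference commutes with [x] and kills the cyclic vector, so it is 0. *)
Lemma centralizer_polm i x v y : kr x v \in unitmx ->
  level i (x * y - y * x) -> exists c, level i (y - polm x c).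
Proof.
move=> u h; exists (invmx (kr x v) *m (y *m v)).
set z := y - _; apply/eqP.
have hz : level i (x * z - z * x).
  by rewrite /z mulrBr mulrBl (polm_comm _ (erefl (x * x))) opprB addrA subrK.
apply: (krylov_comm_eq0 u).
  by apply/eqP; rewrite eq_sym -subr_eq0 -scalerAl -scalerAr -scalerBr.
by rewrite -scalemxAl mulmxBl polm_cyclic // subrr scaler0.
Qed.

Lemma levelXB i x y k : level i (x - y) -> level i (x ^+ k - y ^+ k).
Proof.
move=> h; elim: k => [|k IHk]; first by rewrite subrr level0.
have -> : x ^+ k.+1 - y ^+ k.+1 = x * (x ^+ k - y ^+ k) + (x - y) * y ^+ k.
  by rewrite mulrBr mulrBl -!exprS addrA subrK.
by apply: levelD; [apply: levelMl | apply: levelMr].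
Qed.

Lemma level_polm i x y c : level i (x - y) -> level i (polm x c - polm y c).
Proof.
move=> h; rewrite /polm -sumrB; apply: level_sum => j _.
by rewrite -scalerBr levelZ // levelXB.
Qed.

Lemma krylov_unit_level1 x y v : level 1 (x - y) -> kr x v \in unitmx ->
  kr y v \in unitmx.
Proof.
move=> h; apply: (unit_level1 S); apply/eqP/matrixP => i j.
have /eqP/(congr1 (mulmx^~ v))/matrixP/(_ i 0) := levelXB j h.
rewrite -scalemxAl mulmxBl mul0mx !mxE => e; exact: e.
Qed.

(** The coefficients come from the characteristic polynomial, so one [c] serves all conjugates;
    [hess_conj] needs it for [x] and for a conjugate at once. *)
Lemma Cayley_polm x : exists c, forall g, g \is a GRing.unit ->
  (g * x * g^-1) ^+ m.+1 = polm (g * x * g^-1) c.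
Proof.
pose q := 'X^(m.+1) - char_poly x.
have sq : (size q <= m.+1)%N.
  apply/leq_sizeP => j; rewrite leq_eqVlt => /orP[/eqP<-|hj].
    rewrite coefB coefXn eqxx; have /monicP := char_poly_monic x.
    by rewrite /lead_coef size_char_poly /= => ->; rewrite subrr.
  rewrite coefB coefXn gtn_eqF // sub0r nth_default ?oppr0 //.
  by rewrite size_char_poly.
have hx : x ^+ m.+1 = polm x (\col_j q`_j).
  have : horner_mx x q = x ^+ m.+1.
    by rewrite rmorphB rmorphXn /= horner_mx_X Cayley_Hamilton subr0.
  move <-; have -> : q = \sum_(j < m.+1) q`_j *: 'X^j.
    rewrite -poly_def; apply/polyP => j; rewrite coef_poly; case: ltnP => // h.
    by rewrite nth_default // (leq_trans sq).
  rewrite linear_sum; apply: eq_bigr => j _.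
  rewrite linearZ /= rmorphXn /= horner_mx_X mxE; congr (_ *: _).
  rewrite coef_sum (bigD1 j) //= coefZ coefXn eqxx mulr1 big1 ?addr0 // => k ne.
  by rewrite coefZ coefXn (inj_eq val_inj) eq_sym (negPf ne) mulr0.
have conjX g k : g \is a GRing.unit -> (g * x * g^-1) ^+ k = g * x ^+ k * g^-1.
  move=> u; elim: k => [|k IHk]; first by rewrite mulr1 mulrV.
  by rewrite !exprS IHk !mulrA mulrVK.
exists (\col_j q`_j) => g u; rewrite conjX // hx /polm mulr_sumr mulr_suml.
by apply: eq_bigr => j _; rewrite conjX // -scalerAr -scalerAl.
Qed.

End Krylov.

(** * Hessenberg matrices and their conjugacy under [U] *)

Section Hessenberg.
Variables (R : finComUnitRingType) (l a b : nat) (w : R) (phi : R -> algC).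
Hypothesis S : setting l a b w phi.
Variable m : nat.
Local Notation M := 'M[R]_m.+1.
Local Notation level := (@level R l w m).
Local Notation kr := (@krylov m.+1 R).
Local Notation e0 := (delta_mx 0 0 : 'cV[R]_m.+1).
Implicit Types x y g : M.

Definition hess x := forall i j : 'I_m.+1, (j < i)%N ->
  if i == j.+1 :> nat then is_true (x i j \is a GRing.unit) else x i j = 0.

(** These are the only entries of [x] seen by the function [u |-> phi (tr (x (u - 1)))] on [U]. *)
Definition samelow x y := forall i j : 'I_m.+1, (j < i)%N -> x i j = y i j.

Definition supper (y : M) : bool :=
  [forall i : 'I_m.+1, forall j : 'I_m.+1, (j <= i)%N ==> (y i j == 0)].

Lemma supperP y :
  reflect (forall i j : 'I_m.+1, (j <= i)%N -> y i j = 0) (supper y).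
Proof.
apply: (iffP forallP) => [h i j ji | h i].
  by have /forallP/(_ j)/implyP/(_ ji)/eqP := h i.
by apply/forallP => j; apply/implyP => /h/eqP.
Qed.

Lemma samelow_hess x y : samelow x y -> hess x -> hess y.
Proof. by move=> h hx i j ji; rewrite -h //; apply: hx. Qed.

(** The [j]-th diagonal entry of the Krylov matrix of a Hessenberg [x] at [e0]. *)
Definition subdiag_prod x (j : nat) : R := \prod_(k < j) x (inord k.+1) (inord k).

Lemma krylov_hess x (j : nat) (i : 'I_m.+1) : hess x -> (j <= i)%N ->
  (x ^+ j *m e0) i 0 = if i == j :> nat then subdiag_prod x j else 0.
Proof.
move=> hx; elim: j i => [|j IHj] i ji.
  rewrite expr0 mul1mx !mxE /subdiag_prod big_ord0 -val_eqE /=.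
  by rewrite eqxx andbT; case: eqP.
have lt_jm : (j < m.+1)%N by apply: leq_trans ji (ltnW (ltn_ord i)).
rewrite exprS -mulmxE -mulmxA mxE (bigD1 (Ordinal lt_jm)) //= big1 ?addr0.
  rewrite IHj //= eqxx /subdiag_prod big_ord_recr /= -/(subdiag_prod x j).
  have ej : inord j = Ordinal lt_jm :> 'I_m.+1 by apply: val_inj; rewrite /= inordK.
  have := hx i (Ordinal lt_jm) ji; case: eqP => [/= e _|_ ->]; last by rewrite mul0r.
  rewrite mulrC ej; congr (_ * x _ _).
  by apply: val_inj; rewrite /= inordK -e.
move=> k; rewrite -val_eqE /= => ne; case: (ltnP k j) => kj.
  have ki : (k < i)%N by apply: ltn_trans kj ji.
  have := hx i k ki; case: eqP => [e|_ ->]; last by rewrite mul0r.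
  by move: ji; rewrite e ltnNge kj.
by rewrite IHj // (negPf ne) mulr0.
Qed.

Lemma subdiag_unit x (j : 'I_m.+1) : hess x -> subdiag_prod x j \is a GRing.unit.
Proof.
move=> hx; rewrite /subdiag_prod; elim/big_ind: _ => [||k _].
- exact: unitr1.
- by move=> r s ur us; rewrite unitrM ur.
have km : (k.+1 < m.+1)%N by apply: leq_ltn_trans (ltn_ord j).
have := hx (inord k.+1) (inord k); rewrite !inordK ?(ltnW km) // eqxx.
by apply.
Qed.

Lemma subdiag_samelow x y (j : 'I_m.+1) : samelow x y ->
  subdiag_prod x j = subdiag_prod y j.
Proof.
move=> h; apply: eq_bigr => k _; apply: h.
have km : (k.+1 < m.+1)%N by apply: leq_ltn_trans (ltn_ord j).
by rewrite !inordK ?(ltnW km).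
Qed.

Lemma krylov_hessE x (i j : 'I_m.+1) : hess x -> (j <= i)%N ->
  kr x e0 i j = if i == j then subdiag_prod x j else 0.
Proof. by move=> hx ji; rewrite mxE krylov_hess. Qed.

Lemma krylov_hess_unit x : hess x -> kr x e0 \in unitmx.
Proof.
move=> hx; rewrite unitmxE -det_tr det_trig.
  elim/big_ind: _ => [||k _]; first exact: unitr1.
    by move=> r s ur us; rewrite unitrM ur.
  by rewrite mxE krylov_hessE // eqxx subdiag_unit.
apply/is_trig_mxP => i j ij; rewrite mxE krylov_hessE // 1?ltnW //.
by rewrite -val_eqE /= gtn_eqF.
Qed.

(* The conjugating element is the change of Krylov basis. *)
Lemma hess_conj i x y g : hess x -> samelow x y -> g \is a GRing.unit ->
  level i (y - g * x * g^-1) ->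
  exists u, [/\ u \is a GRing.unit, supper (u - 1) & level i (y - u * x * u^-1)].
Proof.
move=> hx hxy ug hg; have hy := samelow_hess hxy hx.
have ux := krylov_hess_unit hx; have uy := krylov_hess_unit hy.
have [u uu ek] : exists2 u : M, u \is a GRing.unit & u *m kr x e0 = kr y e0.
  exists (kr y e0 *m invmx (kr x e0)); last by rewrite mulmxKV.
  by rewrite -[_ \is a _]/(_ \in unitmx) unitmx_mul unitmx_inv uy ux.
have ekj (j : 'I_m.+1) : u *m (x ^+ j *m e0) = y ^+ j *m e0.
  apply/matrixP => p q; rewrite ord1 mxE.
  have /matrixP/(_ p j) := ek; rewrite !mxE => <-.
  by apply: eq_bigr => k _; rewrite [kr x e0 k j]mxE.
exists u; split=> //.
  (* Both Krylov matrices are upper triangular with the same diagonal, since [x] and [y] agree below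
     the diagonal; solving column by column shows that [u] is unipotent. *)
  apply/supperP; suff h (j : nat) (p q : 'I_m.+1) : (q <= p)%N -> q = j :> nat ->
      (u - 1) p q = 0 by move=> p q pq; apply: (h q).
  elim/ltn_ind: j p q => j IHj p q qp ej; rewrite 2!mxE.
  have /matrixP/(_ p q) := ek; rewrite mxE (bigD1 q) //= big1 ?addr0 => [|k ne].
    rewrite !krylov_hessE // eqxx [(1 : M) p q]mxE.
    have uq := subdiag_unit q hx; rewrite (subdiag_samelow _ hxy) in uq *.
    by case: eqP => _ e; apply: (mulIr uq); rewrite mulrBl e ?mul1r ?mul0r ?subrr ?subr0.
  case: (ltnP k q) => kq.
    have := IHj k _ p k _ erefl; rewrite -ej => /(_ kq (leq_trans (ltnW kq) qp)).
    rewrite 2!mxE [(1 : M) p k]mxE -val_eqE /= gtn_eqF ?subr0 => [->|]; first by rewrite mul0r.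
    exact: leq_trans kq qp.
  by rewrite (krylov_hessE hx kq) (negPf ne) mulr0.
suff h : level i (y * u - u * x).
  by rewrite -[y](mulrK uu) -mulrBl levelMr.
apply/eqP/(krylov_eq0 ux) => j; rewrite -scalemxAl mulmxBl -mulmxE -!mulmxA ekj.
rewrite [y *m (_ *m _)]mulmxA [x *m (_ *m _)]mulmxA !mulmxE -!exprS.
have [lt_jm|] := ltnP j.+1 m.+1.
  by rewrite (ekj (Ordinal lt_jm)) subrr scaler0.
rewrite ltnS leq_eqVlt ltnNge -ltnS ltn_ord orbF => /eqP em.
(* Only the last Krylov vector is left: [x] and [g x g^-1] satisfy the same relation of degree
   [m.+1], and [y] is congruent to the latter modulo [w^i]. *)
rewrite -em; have [c hc] := Cayley_polm x.
have hx1 := hc 1 (unitr1 _); rewrite mul1r invr1 mulr1 in hx1.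
rewrite hx1 -[polm x c *m e0]krylov_mul mulmxA ek krylov_mul.
rewrite -mulmxBl scalemxAl; suff /eqP -> : level i (y ^+ m.+1 - polm y c).
  by rewrite mul0mx.
set z := g * x * g^-1 in hg.
have hz : z ^+ m.+1 = polm z c := hc g ug.
have -> : y ^+ m.+1 - polm y c =
    (y ^+ m.+1 - z ^+ m.+1) + (polm z c - polm y c) by rewrite hz; mx_zmod.
by rewrite levelD ?levelXB ?level_polm // levelBC.
Qed.

(** In the Krylov basis [x] becomes a companion matrix. Rescaling the first basis vector by the
    inverse determinant puts [g] in SL_n; below the diagonal this only turns the first subdiagonal 1
    into another unit. *)
Lemma regular_hess x v : kr x v \in unitmx -> exists g : M,
  [/\ g \is a GRing.unit, \det g = 1 & hess (g^-1 * x * g)].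
Proof.
move=> uk; pose d (j : 'I_m.+1) := if j == 0 then (\det (kr x v))^-1 else 1.
have ud j : d j \is a GRing.unit.
  by rewrite /d; case: ifP; rewrite ?unitr1 // unitrV -unitmxE.
pose g : M := kr x v *m diag_mx (\row_j d j).
have dg : \det g = 1.
  rewrite det_mulmx det_diag big_ord_recl big1 => [|j _]; rewrite mxE /d //=.
  by rewrite mulr1 mulrV // -unitmxE.
have ug : g \is a GRing.unit by rewrite -[g \is a _]/(g \in unitmx) unitmxE dg unitr1.
exists g; split=> // i j ji.
have jm : (j.+1 < m.+1)%N by apply: leq_ltn_trans (ltn_ord i).
pose j' := Ordinal jm.
have gE p q : g p q = (x ^+ q *m v) p 0 * d q.
  by rewrite /g mul_mx_diag !mxE; congr (_ * _); rewrite mxE.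
have e : col j (x * g) = d j *: col j' g.
  apply/matrixP => p q; rewrite 4!mxE gE {2}/d /= mulr1 exprS -mulmxE -mulmxA.
  rewrite [RHS]mulrC [in RHS]mxE big_distrl /=; apply: eq_bigr => k _.
  by rewrite gE mulrA.
have : col j (g^-1 * (x * g)) = d j *: col j' (g^-1 * g).
  by rewrite -!mulmxE !colE -mulmxA -colE e -scalemxAr colE mulmxA.
rewrite mulVr // mulrA => /matrixP/(_ i 0); rewrite 4!mxE => ->; rewrite mxE -val_eqE /=.
by case: eqP; rewrite ?mulr1 ?mulr0.
Qed.

End Hessenberg.


(** * Lifting centralizer elements so that [om] is trivial on their commutators *)

Section GoodLift.
Variables (R : finComUnitRingType) (l a b : nat) (w : R) (phi : R -> algC).
Hypothesis S : setting l a b w phi.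
Variable m : nat.
Local Notation M := 'M[R]_m.+1.
Local Notation level := (@level R l w m).
Implicit Types (x y g Y D N : M).

Let lE : l = (a + b)%N := l_split S.
Let a0 : (0 < a)%N := a_gt0 S.
Let ab : (a <= b)%N := le_a_b S.
Let b2a : (b <= a.*2)%N := le_b_2a S.

Lemma mxtraceBE (Y D : M) : \tr (Y - D) = \tr Y - \tr D.
Proof. exact: raddfB. Qed.

Lemma mxtraceN (Y : M) : \tr (- Y) = - \tr Y.
Proof. exact: raddfN. Qed.

Lemma conj_sub (h g h' g' Y : M) :
  h * Y * h' - Y - (g * Y * g' - Y) = (h - g) * Y * h' + g * Y * (h' - g').
Proof. rewrite !(mulrBl, mulrBr); mx_zmod. Qed.

(** From [b <= a.*2] one gets [l <= 3 a]. Together with [level_aa] this lets computations in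
    [1 + w^a M] stop at second order. *)
Lemma level_aaa Y D N : level a Y -> level a D -> level a N -> Y * D * N = 0.
Proof.
by move=> hY hD hN; apply: (levelM0 S (i := a + a) _ _ hN); [lia | exact: (levelM S hY hD)].
Qed.

Lemma level_aa Y D : level a Y -> level a D -> level b (Y * D).
Proof. by move=> hY hD; apply: (level_le _ (levelM S hY hD)); lia. Qed.

Lemma level_ab0 Y D : level a Y -> level b D -> Y * D = 0.
Proof. by move=> hY hD; apply: (levelM0 S _ hY hD); lia. Qed.

Lemma level_ba0 Y D : level b Y -> level a D -> Y * D = 0.
Proof. by move=> hY hD; apply: (levelM0 S _ hY hD); lia. Qed.

Lemma level_b_a Y : level b Y -> level a Y.
Proof. exact: level_le. Qed.

Lemma level_a1 Y : level a Y -> level 1 Y.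
Proof. exact: level_le. Qed.

Lemma unit1D Y : level a Y -> 1 + Y \is a GRing.unit.
Proof. by move/level_a1/(level1_unit S). Qed.

Lemma level_comm i x Y : level i Y -> level i (x * Y - Y * x).
Proof. by move=> h; apply: levelB; [apply: levelMl | apply: levelMr]. Qed.

(* The radical of the commutator form [phi (tr (x (Y Y' - Y' Y)))] on [w^a M]. *)
Definition radical x Y : bool := level a Y && level b (x * Y - Y * x).

Lemma radical_b x Y : level b Y -> radical x Y.
Proof. by move=> h; rewrite /radical level_b_a // level_comm. Qed.

Lemma radicalDb x Y N : level b N -> radical x (Y + N) = radical x Y.
Proof.
move=> h; rewrite [LHS]/radical [RHS]/radical (levelDr _ (level_b_a h)); congr (_ && _).
have -> : x * (Y + N) - (Y + N) * x = (x * Y - Y * x) + (x * N - N * x).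
  by rewrite !(mulrDr, mulrDl); mx_zmod.
by rewrite levelDr // level_comm.
Qed.

Lemma radicalD x Y D : radical x Y -> radical x D -> radical x (Y + D).
Proof.
move=> /andP[hY hY'] /andP[hD hD']; rewrite /radical levelD //.
have -> : x * (Y + D) - (Y + D) * x = (x * Y - Y * x) + (x * D - D * x).
  by rewrite !(mulrDr, mulrDl); mx_zmod.
exact: levelD.
Qed.

(** [om Y] stands for the scalar by which [1 + Y] acts; the product of [1 + Y] and [1 + D] is
    [1 + (Y + D + Y * D)]. *)
Variables (x : M) (om : M -> algC).
Hypothesis omM : forall Y D, radical x Y -> radical x D ->
  om (Y + D + Y * D) = om Y * om D.
Hypothesis om_b : forall Y, level b Y -> om Y = phi (\tr (x * Y)).

Local Notation tr A := (\tr (A)).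

Let omDb D N : radical x D -> level b N -> om (D + N) = om D * phi (tr (x * N)).
Proof.
move=> hD hN; have /andP[aD _] := hD; rewrite -om_b // -omM //; last exact: radical_b.
by rewrite (level_ab0 aD hN) addr0.
Qed.

Let omD D N : radical x D -> radical x N ->
  om D * om N = om (D + N) * phi (tr (x * (D * N))).
Proof.
move=> hD hN; rewrite -omM // omDb ?radicalD //; apply: level_aa.
  by case/andP: hD.
by case/andP: hN.
Qed.

(** Dividing [om] by [phi_x] leaves a function of [D] modulo [w^b], multiplicative up to the
    quadratic factor in [r_mul]. *)
Let r D := om D * phi (- tr (x * D)).

Let r_b D N : radical x D -> level b N -> r (D + N) = r D.
Proof.
move=> hD hN; rewrite /r omDb // mulrDr mxtraceD opprD !(phi_D S).
by rewrite -mulrA; congr (_ * _); rewrite mulrCA -(phi_D S) subrr (phi_0 S) mulr1.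
Qed.

Let r_mul D N : radical x D -> radical x N ->
  r D * r N = r (D + N) * phi (tr (x * (D * N))).
Proof.
move=> hD hN; rewrite /r mulrACA omD // mulrDr mxtraceD opprD !(phi_D S).
by rewrite -!mulrA; congr (_ * _); rewrite mulrC !mulrA.
Qed.

Variable (c : 'cV[R]_m.+1).
Let g := polm x c.
Hypothesis ug : g \is a GRing.unit.

Let gx : x * g = g * x. Proof. exact: polm_comm. Qed.
(** [D0 Y] is the first-order part of the commutator of [g] with [1 + Y], and [A] selects the [Y]
    for which it falls in the radical. Since [g] commutes with [x], [D0 Y] has trace 0 against [x],
    and [Theta Y] is the value of [om] at that commutator. *)
Let D0 Y := g * Y * g^-1 - Y.
Let A Y := level a Y && radical x (D0 Y).
Let Theta Y := r (D0 Y) * phi (- tr (x * (D0 Y * Y))).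

Let D0D Y N : D0 (Y + N) = D0 Y + D0 N.
Proof. by rewrite /D0 !(mulrDr, mulrDl) opprD; mx_zmod. Qed.

Let AD Y N : A Y -> A N -> A (Y + N).
Proof.
move=> /andP[hY hY'] /andP[hN hN']; rewrite /A D0D (levelD hY hN).
exact: radicalD.
Qed.

Let AN Y : A Y -> A (- Y).
Proof.
rewrite /A levelN => /andP[-> /andP[h1 h2]] /=.
have -> : D0 (- Y) = - D0 Y by rewrite /D0 mulrN mulNr opprD.
by rewrite /radical levelN h1 mulrN mulNr -opprD levelN.
Qed.

Let Theta_D Y N : A Y -> A N -> Theta (Y + N) = Theta Y * Theta N.
Proof.
move=> /andP[hY hDY] /andP[hN hDN]; rewrite /Theta mulrACA r_mul // -D0D.
move: (r _) => rYN; rewrite -mulrA -!(phi_D S); congr (_ * phi _).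
(* Conjugation by [g] fixes [x], hence preserves the form [tr (x * Y * N)]. *)
have e1 : tr (x * (D0 Y + Y) * (D0 N + N)) = tr (x * Y * N).
  have -> : D0 Y + Y = g * Y * g^-1 by rewrite subrK.
  have -> : D0 N + N = g * N * g^-1 by rewrite subrK.
  rewrite !mulrA mulrVK // gx -!mulrA mxtraceC -!mulrA mulVr // mulr1.
  by rewrite mulrA.
(* [D0 N] commutes with [x] modulo [w^b], so it pairs symmetrically with [Y] in [w^a M]. *)
have e2 : tr (x * Y * D0 N) = tr (x * D0 N * Y).
  have /andP[_ hc] := hDN.
  have := level_ab0 hY hc; rewrite mulrBr => /(congr1 (@mxtrace _ _)).
  rewrite mxtraceBE mxtrace0 => /eqP; rewrite subr_eq0 => /eqP.
  by move=> e; rewrite -mulrA mxtraceC -mulrA -e mxtraceC.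
rewrite D0D; move: (D0 Y) (D0 N) e1 e2 => D D' e1 e2.
move: e1; rewrite !(mulrDr, mulrDl) !mxtraceD !mulrA e2 => /eqP.
rewrite -subr_eq0 => /eqP e1; apply/eqP; rewrite -subr_eq0; apply/eqP; rewrite -[RHS]oppr0.
by apply: (etrans _ (congr1 -%R e1)); ring.
Qed.

Let Theta_1 Y : A Y -> level b (D0 Y) -> Theta Y = 1.
Proof.
move=> /andP[hY _] hD; rewrite /Theta /r om_b // -(phi_D S) subrr (phi_0 S) mul1r.
by rewrite (level_ba0 hD hY) mulr0 mxtrace0 oppr0 (phi_0 S).
Qed.

(** The value that replaces [Theta Y] when [g] is rebuilt from [x + w ^+ a *: t] with the same
    coefficients [c]. *)
Let twist t Y := Theta Y * phi (\tr (- (w ^+ a *: D0 Y) * t)).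

Let twist_D t Y N : A Y -> A N -> twist t (Y + N) = twist t Y * twist t N.
Proof.
move=> hY hN; rewrite /twist Theta_D // D0D; move: (Theta Y) (Theta N) => u v.
by rewrite mulrACA -(phi_D S) -mxtraceD -mulrDl -opprD -scalerDr.
Qed.

Let level_lb Y : level b Y = (w ^+ a *: Y == 0).
Proof. by rewrite /level lE addnK. Qed.

(** Sum over [t] first: this selects the [Y] with [D0 Y] in [w^b M], where [Theta] is 1, so the
    double sum is positive. Hence for some [t] the sum over [A] is nonzero, which forces the
    character [twist t] to be trivial. *)
Let exists_twist : exists t, forall Y, A Y -> twist t Y = 1.
Proof.
have sum_neq0 : \sum_t \sum_(Y | A Y) twist t Y != 0.
  rewrite exchange_big (eq_bigr (fun Y => (level b (D0 Y))%:R * #|{: M}|%:R)) /=.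
    rewrite -mulr_suml -natr_sum -natrM pnatr_eq0 muln_eq0 negb_or -!lt0n.
    apply/andP; split; last by apply/card_gt0P; exists 0.
    rewrite (bigD1 0) /=; last first.
      by rewrite /A /D0 mulr0 mul0r subrr level0 radical_b ?level0.
    by rewrite /D0 mulr0 mul0r subrr level0.
  move=> Y hY; rewrite -mulr_sumr (sum_phi_tr S) oppr_eq0.
  rewrite -level_lb.
  by case: ifP => h; rewrite ?mulr0 ?mul0r // Theta_1.
have [t ht] : exists t, \sum_(Y | A Y) twist t Y != 0.
  apply/existsP; apply: contraNT sum_neq0 => /existsPn h.
  by rewrite big1 // => t _; apply/eqP; have := h t; rewrite negbK.
exists t => Y hY; apply/eqP; apply: contraNT ht => nY; apply/eqP.
have /andP[_ _] := hY.
apply: (@sum_char_eq0 _ _ _ Y) => //.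
  move=> N; apply/idP/idP => hN; last exact: AD.
  by rewrite -(addrK Y N) AD ?AN.
by move=> N hN; rewrite twist_D.
Qed.

(* [g] is moved inside its coset [g (1 + w^a M)] by deforming [x]. *)
Lemma good_lift : exists t, let h := polm (x + w ^+ a *: t) c in
  [/\ h \is a GRing.unit, level a (h - g) &
   forall Y, level a Y ->
     let Q := h * (1 + Y) * h^-1 * (1 + Y)^-1 - 1 in radical x Q -> om Q = 1].
Proof.
have [t ht] := exists_twist; exists t; set xt := x + _; set h := polm xt c.
have axt : level a (xt - x) by rewrite addrC addKr (level_w S).
have ahg : level a (h - g) by exact: level_polm.
have uh : h \is a GRing.unit.
  by apply: (unit_level1 S) ug; rewrite levelBC level_a1.
have hxt : xt * h = h * xt by exact: polm_comm.
split=> // Y hY Q; have uY := unit1D hY.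
pose D := h * Y * h^-1 - Y.
have aD : level a D by apply: levelB => //; apply/levelMr/levelMl.
have eQ : Q = D - D * Y.
  apply: (mulIr uY); rewrite /Q mulrBl mul1r mulrVK // mulrBl.
  have -> : D * Y * (1 + Y) = D * Y by rewrite mulrDr mulr1 level_aaa ?addr0.
  rewrite [D * (1 + Y)]mulrDr mulr1 addrK /D mulrDr mulr1 mulrDl mulrV //.
  by mx_zmod.
have bDY : level b (- (D * Y)) by rewrite levelN level_aa.
rewrite eQ radicalDb // => rD; rewrite omDb //.
have bDD : level b (D - D0 Y).
  have -> : D - D0 Y = (h - g) * Y * h^-1 + g * Y * (h^-1 - g^-1).
    by rewrite /D /D0 conj_sub.
  apply: levelD; first by apply/levelMr/level_aa.
  by rewrite -mulrA; apply/levelMl/level_aa => //; apply: (level1_inv uh ug).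
have eD : D = D0 Y + (D - D0 Y) by rewrite addrC subrK.
have rD0 : radical x (D0 Y) by move: rD; rewrite {1}eD radicalDb.
have := ht Y; rewrite /A hY rD0 => /(_ isT); rewrite /twist.
(* [xt] commutes with [h], so [D] has trace 0 against [xt]; its trace against [x] is the
   contribution of [- w ^+ a *: t]. *)
have -> : \tr (- (w ^+ a *: D0 Y) * t) = \tr (x * D).
  have -> : w ^+ a *: D0 Y = w ^+ a *: D.
    apply/eqP; rewrite -subr_eq0 -scalerBr -level_lb levelBC.
    exact: bDD.
  have : \tr (xt * D) = 0.
    rewrite /D mulrBr mxtraceBE !mulrA hxt -!mulrA mxtraceC -!mulrA mulVr //.
    by rewrite mulr1 subrr.
  rewrite mulrDl mxtraceD => /eqP; rewrite addr_eq0 => /eqP ->.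
  by rewrite mulNr mxtraceN -!scalerAl !mxtraceZ mxtraceC.
have -> : om D * phi (\tr (x * - (D * Y))) =
    Theta Y * phi (\tr (x * D)).
  rewrite /Theta -(r_b rD0 bDD) -eD /r -!mulrA; congr (_ * _).
  rewrite -!(phi_D S); congr phi.
  have -> : D * Y = D0 Y * Y by rewrite {1}eD mulrDl (level_ba0 bDD hY) addr0.
  by rewrite mulrN mxtraceN; ring.
by [].
Qed.

End GoodLift.


(** [rho] is a function on all matrices, constrained only on [G], which contains SL_n and [1 + w M].
    The last field is irreducibility in Burnside's form. *)
Record matrep (R : finComUnitRingType) (l : nat) (w : R) (m d : nat)
    (G : pred 'M[R]_m.+1) (rho : 'M[R]_m.+1 -> 'M[algC]_d) : Prop := Matrep {
  G_unit : forall A, G A -> A \is a GRing.unit;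
  G_M : forall A B, G A -> G B -> G (A * B);
  G_V : forall A, G A -> G A^-1;
  G_SL : forall A, \det A = 1 -> G A;
  G_K : forall A, level l w 1 (A - 1) -> G A;
  rho_1 : rho 1 = 1%:M;
  rho_M : forall A B, G A -> G B -> rho (A * B) = rho A *m rho B;
  rho_span : forall X, exists c : 'M[R]_m.+1 -> algC,
    X = \sum_(A | G A) c A *: rho A }.

Lemma mul_delta_mxE (F : pzRingType) d (A B : 'M[F]_d) i j p q :
  (A *m delta_mx i j *m B) p q = A p i * B j q.
Proof.
rewrite mxE (bigD1 j) //= big1 ?addr0 => [|k nk].
  rewrite mxE (bigD1 i) //= big1 ?addr0 => [|k nk]; first by rewrite mxE !eqxx mulr1.
  by rewrite mxE (negPf nk) mulr0.
rewrite mxE big1 ?mul0r // => k' _.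
by rewrite mxE (negPf nk) andbF mulr0.
Qed.

(** * Decomposition under [1 + w^b M] and Schur's lemma in a corner *)

Section Idempotents.
Variables (R : finComUnitRingType) (l a b : nat) (w : R) (phi : R -> algC).
Hypothesis S : setting l a b w phi.
Variables (m d : nat) (G : pred 'M[R]_m.+1).
Variable rho : 'M[R]_m.+1 -> 'M[algC]_d.
Hypothesis rep : matrep l w G rho.
Local Notation M := 'M[R]_m.+1.
Local Notation level := (@level R l w m).
Local Notation tr A := (\tr (A)).
Implicit Types (x y g Y D N : M).

Let lE : l = (a + b)%N := l_split S.
Let ab : (a <= b)%N := le_a_b S.
Let rho_M' := rho_M rep.

Lemma sum_shift (V : nmodType) (P : pred M) (F : M -> V) B :
  (forall A, P (A + B) = P A) -> \sum_(A | P A) F A = \sum_(A | P A) F (A + B).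
Proof.
move=> hP; rewrite (reindex (fun A => A + B)) /=; last first.
  by exists (fun A => A - B) => A _; rewrite ?addrK ?subrK.
by apply: eq_bigl => A; rewrite hP.
Qed.

Lemma G_1D Y : level a Y -> G (1 + Y).
Proof. by move=> h; apply: (G_K rep); rewrite addrC addKr (level_a1 S). Qed.

Lemma G_1Db Y : level b Y -> G (1 + Y).
Proof. by move/(level_b_a S)/G_1D. Qed.

Lemma rhoK g : G g -> rho g *m rho g^-1 = 1%:M.
Proof.
by move=> h; rewrite -rho_M' ?(G_V rep) // mulrV ?(G_unit rep) ?(rho_1 rep).
Qed.

Definition Nb : algC := #|[pred Y : M | level b Y]|%:R.

Lemma Nb_neq0 : Nb != 0.
Proof.
rewrite pnatr_eq0 -lt0n; apply/card_gt0P; exists 0; rewrite inE; exact: level0.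
Qed.

(* The idempotent of the character [phi_x] of [1 + w^b M]. *)
Definition eid x : 'M[algC]_d :=
  Nb^-1 *: \sum_(Y | level b Y) phi (- tr (x * Y)) *: rho (1 + Y).

Lemma mul1D_b Y D : level b Y -> level b D -> (1 + Y) * (1 + D) = 1 + (D + Y).
Proof.
move=> hY hD; rewrite mulrDl mul1r mulrDr mulr1 (level_ba0 S hY) ?addr0 ?addrA //.
exact: (level_b_a S hD).
Qed.

Lemma eid_l x Y : level b Y -> rho (1 + Y) *m eid x = phi (tr (x * Y)) *: eid x.
Proof.
move=> hY; rewrite /eid -scalemxAr [RHS]scalerA mulrC -scalerA; congr (_ *: _).
rewrite mulmx_sumr [in RHS](@sum_shift _ _ _ Y) => [|D]; last exact: levelDr.
rewrite scaler_sumr; apply: eq_bigr => D hD; rewrite -scalemxAr.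
rewrite -rho_M' ?G_1Db // mul1D_b // scalerA -(phi_D S) mulrDr mxtraceD.
by rewrite opprD [tr _ + _]addrCA subrr addr0.
Qed.

Lemma eid_r x Y : level b Y -> eid x *m rho (1 + Y) = phi (tr (x * Y)) *: eid x.
Proof.
move=> hY; rewrite -eid_l // /eid -scalemxAr -scalemxAl; congr (_ *: _).
rewrite mulmx_sumr mulmx_suml; apply: eq_bigr => D hD.
rewrite -scalemxAr -scalemxAl; congr (_ *: _).
by rewrite -!rho_M' ?G_1Db // !mul1D_b // [D + Y]addrC.
Qed.

Lemma eid_M x y : eid x *m eid y = if level a (x - y) then eid y else 0.
Proof.
rewrite {1}/eid -scalemxAl mulmx_suml.
rewrite (eq_bigr (fun Y => phi (tr ((y - x) * Y)) *: eid y)) => [|Y hY].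
  rewrite -scaler_suml (sum_phi_level S); last by lia.
  rewrite scalerA levelBC (_ : l - b = a)%N; last by lia.
  by case: ifP => _; rewrite ?mulr0 ?scale0r // mulVf ?scale1r // Nb_neq0.
rewrite -scalemxAl eid_l // scalerA -(phi_D S) mulrBl mxtraceBE.
by rewrite addrC.
Qed.

Lemma eid_idem x : eid x *m eid x = eid x.
Proof. by rewrite eid_M subrr level0. Qed.

Lemma eid_eq x y : level a (x - y) -> eid x = eid y.
Proof.
move=> h; congr (_ *: _); apply: eq_bigr => Y hY; congr (phi (- _) *: _).
apply/eqP; rewrite -subr_eq0 -mxtraceBE -mulrBl (level_ab0 S h hY).
by rewrite mxtrace0.
Qed.

(** Summing over all [x] counts every class modulo [w^a] several times, whence a nonzero scalar
    rather than 1. *)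
Lemma sum_eid : exists2 c, c != 0 & \sum_x eid x = c%:M.
Proof.
exists (Nb^-1 * #|{: M}|%:R).
  rewrite mulf_neq0 ?invr_eq0 ?Nb_neq0 // pnatr_eq0 -lt0n.
  by apply/card_gt0P; exists 0.
rewrite -scaler_sumr exchange_big (bigD1 0) ?level0 //= [X in _ + X]big1.
  rewrite addr0 (eq_bigr (fun=> 1%:M)) => [|x _]; last first.
    by rewrite mulr0 mxtrace0 oppr0 (phi_0 S) scale1r addr0 (rho_1 rep).
  by rewrite sumr_const -scaler_nat scalerA scalemx1.
move=> Y /andP[_ nY]; rewrite -scaler_suml.
rewrite (eq_bigr (fun B => phi (tr (- Y * B)))) => [|x _]; last first.
  by rewrite mulNr mxtraceN mxtraceC.
by rewrite (sum_phi_tr S) oppr_eq0 (negPf nY) scale0r.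
Qed.

Lemma eid_conj x g : G g -> eid x *m rho g = rho g *m eid (g^-1 * x * g).
Proof.
move=> Gg; have ug := G_unit rep Gg.
rewrite /eid -scalemxAr -scalemxAl; congr (_ *: _).
rewrite mulmx_sumr mulmx_suml (reindex (fun Y => g * Y * g^-1)) /=; last first.
  by exists (fun Y => g^-1 * Y * g) => Y _;
    rewrite !mulrA ?(mulVr, mulrV) // ?mul1r -mulrA ?(mulVr, mulrV) // mulr1.
have lg Y : level b (g * Y * g^-1) = level b Y.
  apply/idP/idP => h; last by rewrite levelMr // levelMl.
  have -> : Y = g^-1 * (g * Y * g^-1) * g by rewrite !mulrA mulVr // mul1r mulrVK.
  by rewrite levelMr // levelMl.
apply: eq_big => // Y; rewrite lg => hY; rewrite -scalemxAr -scalemxAl.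
congr (phi (- _) *: _); first by rewrite !mulrA mxtraceC !mulrA.
rewrite -!rho_M' ?G_1Db ?lg //; congr rho.
by rewrite mulrDl mulrDr mul1r mulr1 mulrVK.
Qed.

(** As [phi_x] on [1 + w^b M] depends only on [x] modulo [w^a], these are the elements of [G] fixing
    that character. *)
Definition stab x g : bool := G g && level a (x * g - g * x).

Lemma stab_1D x Y : level a Y -> stab x (1 + Y).
Proof.
move=> h; rewrite /stab G_1D // mulrDr mulrDl mul1r mulr1.
have -> : x + x * Y - (x + Y * x) = x * Y - Y * x by mx_zmod.
exact: level_comm.
Qed.

Lemma stab_conj x g : stab x g -> level a (x - g^-1 * x * g).
Proof.
case/andP=> Gg; have ug := G_unit rep Gg => h.
have -> : x - g^-1 * x * g = - (g^-1 * (x * g - g * x)).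
  by rewrite mulrBr !mulrA mulVr // mul1r opprB.
by rewrite levelN levelMl.
Qed.

Lemma stab_comm x g : stab x g -> eid x *m rho g = rho g *m eid x.
Proof.
move=> h; have /andP[Gg _] := h.
by rewrite eid_conj // (eid_eq (stab_conj h)).
Qed.

Lemma stab_M x g h : stab x g -> stab x h -> stab x (g * h).
Proof.
move=> /andP[Gg hg] /andP[Gh hh]; rewrite /stab (G_M rep) //=.
have -> : x * (g * h) - g * h * x = (x * g - g * x) * h + g * (x * h - h * x).
  by rewrite mulrBl mulrBr !mulrA; mx_zmod.
by apply: levelD; [apply: levelMr | apply: levelMl].
Qed.

Lemma stab_V x g : stab x g -> stab x g^-1.
Proof.
move=> /andP[Gg hg]; rewrite /stab (G_V rep) //=.
have ug := G_unit rep Gg.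
have -> : x * g^-1 - g^-1 * x = g^-1 * (g * x - x * g) * g^-1.
  by rewrite mulrBr mulrBl !mulrA mulVr // mul1r mulrK.
by rewrite levelMr // levelMl // levelBC.
Qed.

Lemma stab_off x g : G g -> ~~ stab x g -> eid x *m rho g *m eid x = 0.
Proof.
move=> Gg; rewrite /stab Gg /= => h; have ug := G_unit rep Gg.
rewrite eid_conj // -mulmxA eid_M; case: ifP; rewrite ?mulmx0 // => h'.
case/negP: h; have -> : x * g - g * x = g * (g^-1 * x * g - x).
  by rewrite mulrBr !mulrA mulrV // mul1r.
exact: levelMl.
Qed.

(** Outside the stabilizer the corner of [rho g] vanishes, because conjugation moves [phi_x] to
    another character; on it [rho g] commutes with the idempotent. *)
Lemma corner_span x X : exists c : M -> algC,
  eid x *m X *m eid x = \sum_(g | stab x g) c g *: (eid x *m rho g).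
Proof.
have [c ->] := rho_span rep X; exists c.
rewrite mulmx_sumr mulmx_suml (bigID (stab x)) /= [X in _ + X]big1 => [|g].
  rewrite addr0; apply: eq_big => [g|g /andP[_ sg]].
    by apply: andb_idl => /andP[].
  rewrite -(scalemxAr (c g)) -(scalemxAl (c g)) stab_comm //.
  by rewrite -mulmxA eid_idem.
case/andP=> Gg ng; rewrite -(scalemxAr (c g)) -(scalemxAl (c g)) stab_off //.
by rewrite scaler0.
Qed.

(* Schur's lemma for the corner [eid x * M_d * eid x]. *)
Lemma eid_schur x X : eid x *m X = X -> X *m eid x = X ->
  (forall g, stab x g -> X *m rho g = rho g *m X) -> exists c, X = c *: eid x.
Proof.
set e := eid x => eX Xe hX.
(* [X] commutes with the spanning set of the corner, hence with the corner of every matrix [Y]. *)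
have comm (Y : 'M[algC]_d) : X *m Y *m e = e *m Y *m X.
  have [c hc] := corner_span x Y.
  have : X *m (e *m Y *m e) = e *m Y *m e *m X.
    rewrite hc mulmx_sumr mulmx_suml; apply: eq_bigr => g sg.
    rewrite -(scalemxAr (c g)) -(scalemxAl (c g)); congr (_ *: _).
    by rewrite -/e mulmxA Xe hX // stab_comm // -/e -mulmxA eX.
  by rewrite !mulmxA Xe -!mulmxA eX !mulmxA.
have [e0|] := eqVneq e 0; first by exists 0; rewrite -eX e0 mul0mx scale0r.
(* Taking a matrix unit for [Y] in [comm] compares single entries and shows that [X] is proportional
   to [e]. *)
case/matrix0Pn => j [q ne]; exists (X j q / e j q).
apply/matrixP => p i; rewrite mxE.
have := comm (delta_mx i j) => /matrixP/(_ p q); rewrite !mul_delta_mxE => h.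
by rewrite mulrAC [_ * e p i]mulrC -h mulfK.
Qed.

End Idempotents.


(** * The corner as a Heisenberg representation of [1 + w^a M] *)

Section Heisenberg.
Variables (R : finComUnitRingType) (l a b : nat) (w : R) (phi : R -> algC).
Hypothesis S : setting l a b w phi.
Variables (m d : nat) (G : pred 'M[R]_m.+1).
Variable rho : 'M[R]_m.+1 -> 'M[algC]_d.
Hypothesis rep : matrep l w G rho.
Local Notation M := 'M[R]_m.+1.
Local Notation level := (@level R l w m).
Local Notation radical := (@radical R l a b w m).
Local Notation stab := (@stab R l a w m G).
Local Notation tr A := (\tr (A)).
Variables (x : M) (v : 'cV[R]_m.+1).
Hypothesis cyclic_v : @krylov m.+1 R x v \in unitmx.
Local Notation e := (@eid R l b w phi m d rho x).
Implicit Types (g Y D N Q : M).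

Let lE : l = (a + b)%N := l_split S.
Let ab : (a <= b)%N := le_a_b S.
Let b2a : (b <= a.*2)%N := le_b_2a S.
Let rho_M' := rho_M rep.

Lemma level_waE Y : level b (w ^+ a *: Y) = level (l - a.*2) Y.
Proof.
rewrite /level scalerA -exprD; congr (w ^+ _ *: _ == _); lia.
Qed.

(** Dividing by [w ^+ a] turns the radical condition into commuting with [x] modulo [w^(l - 2a)],
    where [centralizer_polm] applies. *)
Lemma radical_polm Y : radical x Y -> exists c, level b (Y - w ^+ a *: polm x c).
Proof.
case/andP=> aY; have [y ->] : exists y, Y = w ^+ a *: y by apply: (levelP S _ aY); lia.
rewrite -scalerAr -scalerAl -scalerBr level_waE => /(centralizer_polm cyclic_v)[c].
by rewrite -level_waE scalerBr; exists c.
Qed.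

(** [g] modulo [w^a] and [Y] modulo [w^b] are polynomials [f] and [Y0] in [x], which commute. Only
    the terms linear in the two errors survive, and they have trace 0 against [x]; hence [phi_x] is
    trivial on these commutators. *)
Lemma comm_radical g Y : g \is a GRing.unit -> level a (x * g - g * x) ->
  radical x Y -> let k := g * (1 + Y) * g^-1 * (1 + Y)^-1 in
  level b (k - 1) /\ tr (x * (k - 1)) = 0.
Proof.
move=> ug hg rY k; have /andP[aY _] := rY; have uY := unit1D S aY.
have [c bN] := radical_polm rY; have [c' am] := centralizer_polm cyclic_v hg.
set Y0 := w ^+ a *: _ in bN; set f := polm x c' in am.
have uf : f \is a GRing.unit by apply: (unit_level1 S) ug; apply: (level_a1 S _).
have aY0 : level a Y0 by apply: (level_w S _ _).
have xY0 : x * Y0 = Y0 * x by rewrite -scalerAr -scalerAl polm_comm.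
have xf : x * f = f * x by rewrite polm_comm.
have fY0 : f * Y0 = Y0 * f by rewrite -scalerAr -scalerAl polm_comm // xf.
pose q := g^-1 * (1 + Y)^-1.
pose E := g * Y - Y * g.
have kE : k - 1 = E * q.
  have -> : E = g * (1 + Y) - (1 + Y) * g.
    by rewrite /E mulrDr mulrDl mulr1 mul1r; mx_zmod.
  by rewrite /q /k mulrBl !mulrA mulrK // mulrV.
move: (Y0) (f) bN am aY0 xY0 xf fY0 uf => {}Y0 {}f bN am aY0 xY0 xf fY0 uf.
have EE : E = ((g - f) * Y0 - Y0 * (g - f)) + (f * (Y - Y0) - (Y - Y0) * f).
  have e1 : (g - f) * (Y - Y0) = 0 by apply: (level_ab0 S _ _).
  have e2 : (Y - Y0) * (g - f) = 0 by apply: (level_ba0 S _ _).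
  rewrite -[LHS]addr0 -[X in _ + X]oppr0 -{1}e1 -[LHS]addr0 -{1}e2 /E.
  by rewrite !(mulrBl, mulrBr) fY0; mx_zmod.
have bE : level b E.
  rewrite EE; apply: levelD; last exact: level_comm.
  by apply: levelB; apply: (level_aa S).
rewrite kE; split; first exact: levelMr.
(* [E] lies in [w^b M], so [q] may be replaced by [f^-1], which is congruent to it modulo [w^a] and
   commutes with [x] and [Y0]. *)
have -> : E * q = E * f^-1.
  apply/eqP; rewrite -subr_eq0 -mulrBr; apply/eqP; apply: (level_ba0 S bE).
  rewrite /q -invrM //; apply: (level1_inv _ uf); first by rewrite unitrMr.
  have -> : (1 + Y) * g - f = (g - f) + Y * g by rewrite mulrDl mul1r; mx_zmod.
  by apply: levelD => //; apply: levelMr.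
rewrite EE; move: (g - f) (Y - Y0) => h N.
have fx : f^-1 * x = x * f^-1 by rewrite (commrV xf).
have t1 : tr (x * (h * Y0 * f^-1)) = tr (x * (Y0 * h * f^-1)).
  have -> : tr (x * (h * Y0 * f^-1)) = tr (h * (Y0 * (f^-1 * x))).
    by rewrite mxtraceC !mulrA.
  have -> : tr (x * (Y0 * h * f^-1)) = tr (h * (f^-1 * (x * Y0))).
    by rewrite -(mulrA Y0) (mulrA x) mxtraceC -(mulrA h).
  have fVY0 : Y0 * f^-1 = f^-1 * Y0 by apply/commrV/esym.
  by rewrite xY0 !mulrA -(mulrA h) fVY0 !mulrA.
have t2 : tr (x * (f * N * f^-1)) = tr (x * (N * f * f^-1)).
  by rewrite mulrK // !mulrA mxtraceC !mulrA fx mulrVK.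
by rewrite mulrDl !mulrBl mulrDr !mulrBr mxtraceD !mxtraceBE t1 t2 !subrr addr0.
Qed.

Hypothesis e_neq0 : e != 0.

Lemma stab_unit g : stab x g -> g \is a GRing.unit.
Proof. by case/andP => /(G_unit rep). Qed.

Lemma stab_G g : stab x g -> G g.
Proof. by case/andP. Qed.

Lemma rho_conj_1D g Y : stab x g -> level a Y ->
  e *m rho (g * (1 + Y) * g^-1 * (1 + Y)^-1) *m rho (1 + Y) *m rho g =
  e *m rho g *m rho (1 + Y).
Proof.
move=> sg aY; have ug := stab_unit sg; have uY := unit1D S aY.
have GY := G_1D S rep aY; have Gg := stab_G sg.
rewrite -!mulmxA -!rho_M' ?(G_M rep, G_V rep) //.
by rewrite !mulrA !mulrVK.
Qed.

(** By [comm_radical] the commutators of [1 + Y] with the stabilizer act trivially on the corner, so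
    Schur's lemma makes [1 + Y] a scalar there. *)
Lemma exists_omega : exists om : M -> algC,
  forall Y, radical x Y -> e *m rho (1 + Y) = om Y *: e.
Proof.
have /matrix0Pn[p [q ne]] := e_neq0.
exists (fun Y => (e *m rho (1 + Y)) p q / e p q) => Y rY.
have /andP[aY _] := rY; have sY := stab_1D S rep x aY.
have [|||c hc] := eid_schur S rep (x := x) (X := e *m rho (1 + Y)).
- by rewrite mulmxA (eid_idem S rep).
- by rewrite -mulmxA -(stab_comm S rep sY) mulmxA (eid_idem S rep).
- move=> g sg; rewrite [RHS]mulmxA -(stab_comm S rep sg) -rho_conj_1D //.
  have /andP[_ cg] := sg.
  have [bk tk] := comm_radical (stab_unit sg) cg rY.
  have := eid_r S rep x bk; rewrite addrC subrK tk (phi_0 S) scale1r => ->.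
  by [].
by rewrite hc mxE mulfK.
Qed.

Variable om : M -> algC.
Hypothesis omE : forall Y, radical x Y -> e *m rho (1 + Y) = om Y *: e.

Lemma scale_e_inj (r s : algC) : r *: e = s *: e -> r = s.
Proof.
have /matrix0Pn[p [q ne]] := e_neq0; move/matrixP/(_ p q).
have E t : (t *: e) p q = t * e p q by rewrite mxE.
by rewrite !E => /(mulIf ne).
Qed.

Lemma radical_a Y : radical x Y -> level a Y.
Proof. by case/andP. Qed.

Lemma om_b Y : level b Y -> om Y = phi (tr (x * Y)).
Proof.
move=> bY; apply: scale_e_inj.
by rewrite -omE ?(eid_r S rep) // (radical_b S).
Qed.

Lemma om_M Y D : radical x Y -> radical x D -> om (Y + D + Y * D) = om Y * om D.
Proof.
move=> rY rD; apply: scale_e_inj.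
have bYD : level b (Y * D) by apply: (level_aa S); apply: radical_a.
have r : radical x (Y + D + Y * D) by rewrite (radicalDb S) // radicalD.
rewrite -(omE r) -scalerA -(omE rD) scalemxAl -(omE rY).
rewrite -mulmxA -rho_M'; try by apply: (G_1D S rep); apply: radical_a.
by congr (_ *m rho _); rewrite mulrDl mul1r mulrDr mulr1; mx_zmod.
Qed.

Definition Na : algC := #|[pred Y : M | level a Y]|%:R.

Lemma conj_1D Y Q : level a Y -> level a Q ->
  (1 + Y) * (1 + Q) * (1 + Y)^-1 = (1 + (Y * Q - Q * Y)) * (1 + Q).
Proof.
move=> aY aQ; have uY := unit1D S aY.
apply: (mulIr uY); rewrite mulrVK //.
have t1 : Y * Q * Q = 0 by apply: (level_aaa S).
have t2 : Q * Y * Q = 0 by apply: (level_aaa S).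
have t3 : Y * Q * Y = 0 by apply: (level_aaa S).
have t4 : Q * Y * Y = 0 by apply: (level_aaa S).
rewrite !(mulrDl, mulrDr, mulNr, mulrN, mul1r, mulr1) ?mulrA t1 t2 t3 t4.
by rewrite ?mul0r; mx_zmod.
Qed.

(** A conjugate of [1 + Q] differs from it by a commutator in [1 + w^b M], which acts through
    [phi_x]; the sum over [Y] is then a character sum that detects the radical. *)
Lemma avg_conj Q : level a Q ->
  \sum_(Y | level a Y) e *m rho ((1 + Y) * (1 + Q) * (1 + Y)^-1) =
  if radical x Q then (Na * om Q) *: e else 0.
Proof.
move=> aQ.
rewrite (eq_bigr (fun Y => phi (tr ((Q * x - x * Q) * Y)) *: (e *m rho (1 + Q)))).
  rewrite -scaler_suml (sum_phi_level S); last by lia.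
  rewrite (_ : l - a = b)%N; last by lia.
  have -> : level b (Q * x - x * Q) = radical x Q by rewrite /radical aQ levelBC.
  by case: ifP => rQ; rewrite ?scale0r // omE ?scalerA.
move=> Y aY; rewrite conj_1D // rho_M' ?(G_1D S rep) //; last first.
  by rewrite levelB // (level_b_a S) // (level_aa S).
rewrite mulmxA (eid_r S rep); last by rewrite levelB // (level_aa S).
rewrite -scalemxAl; congr (phi _ *: _).
rewrite mulrBl mulrBr !mxtraceBE; congr (_ - _); last by rewrite mulrA.
by rewrite mulrA mxtraceC mulrA.
Qed.

Lemma levelMu i Y g : g \is a GRing.unit -> level i (Y * g) = level i Y.
Proof.
move=> ug; apply/idP/idP; last exact: levelMr.
by move/(levelMr g^-1); rewrite mulrK.
Qed.

Lemma levelUM i Y g : g \is a GRing.unit -> level i (g * Y) = level i Y.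
Proof.
move=> ug; apply/idP/idP; last exact: levelMl.
by move/(levelMl g^-1); rewrite mulKr.
Qed.

(* For [h] as in [good_lift], the sum of the conjugates of [rho h^-1] under
   [1 + w^a M] is a nonzero scalar on the corner, which expresses [e rho h]
   through [e rho (1 + w^a M)]. *)
Lemma corner_ind (P : 'M[algC]_d -> Prop) :
  (forall X Z, P X -> P Z -> P (X + Z)) -> (forall r X, P X -> P (r *: X)) ->
  (forall Y, level a Y -> P (e *m rho (1 + Y))) ->
  forall X, P (e *m X *m e).
Proof.
move=> PD PZ P1.
have P0 : P 0 by rewrite -(scale0r (e *m rho (1 + 0))); apply/PZ/P1/level0.
have Psum (J : finType) (Q : pred J) F : (forall j, Q j -> P (F j)) ->
    P (\sum_(j | Q j) F j) by move=> h; elim/big_ind: _.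
suff main g : stab x g -> P (e *m rho g).
  move=> X; have [c ->] := corner_span S rep x X.
  by apply: Psum => g sg; apply/PZ/main.
move=> sg; have /andP[Gg cg] := sg; have ug := stab_unit sg.
have [c am] := centralizer_polm cyclic_v cg.
have uf : polm x c \is a GRing.unit by apply: (unit_level1 S) ug; apply: (level_a1 S _).
have [t] := good_lift S om_M om_b uf; rewrite /=.
set xt := x + w ^+ a *: t; set h := polm xt c => -[uh ahf omh].
have axt : level a (xt - x) by rewrite addrC addKr (level_w S).
have agh : level a (g - h).
  have -> : g - h = (g - polm x c) - (h - polm x c) by mx_zmod.
  exact: levelB.
have Gh : G h.
  have -> : h = g * (g^-1 * h) by rewrite mulVKr.
  apply: (G_M rep) => //; apply: (G_K rep).
  by rewrite -[X in _ - X](mulVr ug) -mulrBr levelMl // levelBC (level_a1 S).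
have sh : stab x h.
  rewrite /stab Gh; have -> : x * h - h * x = (x * (h - g) - (h - g) * x) + (x * g - g * x).
    by rewrite !(mulrBl, mulrBr); mx_zmod.
  by apply: levelD => //; apply: level_comm; rewrite levelBC.
pose K Y := (1 + Y) * h^-1 * (1 + Y)^-1.
have sK Y : level a Y -> stab x (K Y).
  move=> aY; have sY := stab_1D S rep x aY.
  by do 2?apply: (stab_M rep) => //; apply: (stab_V rep).
pose s := \sum_(Y | level a Y) rho (K Y).
have es : e *m s = s *m e.
  rewrite mulmx_sumr mulmx_suml; apply: eq_bigr => Y aY.
  exact: (stab_comm S rep (sK _ aY)).
(* Write [g'] as a polynomial [q] in [xt] up to [1 + w^a M]. As [q] commutes with [h], conjugating
   by [g'] only permutes the terms of [s], through [g' (1 + Y) = (1 + kk Y) q]. *)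
have sC g' : stab x g' -> s *m rho g' = rho g' *m s.
  move=> sg'; have /andP[Gg' cg'] := sg'; have ug' := stab_unit sg'.
  have cycxt : @krylov m.+1 R xt v \in unitmx.
    by apply: (krylov_unit_level1 S) cyclic_v; rewrite levelBC (level_a1 S).
  have [|c' am'] := @centralizer_polm R l w m a xt v g' cycxt.
    have -> : xt * g' - g' * xt =
        (x * g' - g' * x) + ((xt - x) * g' - g' * (xt - x)).
      by rewrite !(mulrBl, mulrBr); mx_zmod.
    apply: levelD => //.
    by apply: levelB; [apply: levelMr | apply: levelMl].
  set q := polm xt c' in am'.
  have uq : q \is a GRing.unit.
    by apply: (unit_level1 S) ug'; apply: (level_a1 S am').
  have qh : h * q = q * h by apply: polm_comm; rewrite [RHS]polm_comm.
  pose kk Y := g' * (1 + Y) * q^-1 - 1.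
  have kkE Y : 1 + kk Y = g' * (1 + Y) * q^-1 by rewrite addrC subrK.
  have akk Y : level a (kk Y) = level a Y.
    have -> : kk Y = ((g' * Y) + (g' - q)) * q^-1.
      by rewrite /kk mulrDr mulr1 !mulrDl mulNr mulrV //; mx_zmod.
    by rewrite levelMu ?unitrV // levelDr // levelUM.
  rewrite mulmx_suml mulmx_sumr (reindex kk) /=; last first.
    exists (fun Y => g'^-1 * (1 + Y) * q - 1) => Y _.
      by rewrite kkE -!mulrA mulVr // mulr1 mulKr // addrC addKr.
    rewrite /kk (_ : 1 + (_ - 1) = g'^-1 * (1 + Y) * q); last by rewrite addrC subrK.
    by rewrite -!mulrA mulrV // mulr1 mulVKr // addrC addKr.
  apply: eq_big => Y; first by rewrite akk.
  rewrite akk => aY; have uY := unit1D S aY.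
  have aY' : level a (kk Y) by rewrite akk.
  have GK Z : level a Z -> G (K Z) by move/sK/stab_G.
  rewrite -!rho_M' ?GK //; congr rho; rewrite /K kkE.
  rewrite !invrM ?unitrV ?unitrMl // invrK !mulrA mulrVK //.
  congr (_ * _); rewrite -!mulrA; congr (_ * (_ * _)).
  by rewrite -(commrV (esym qh)) mulKr.
have [|||la hla] := eid_schur S rep (x := x) (X := s *m e).
- by rewrite mulmxA es -mulmxA (eid_idem S rep).
- by rewrite -mulmxA (eid_idem S rep).
- by move=> g' sg'; rewrite -mulmxA (stab_comm S rep sg') mulmxA sC // !mulmxA.
pose C Y := h * (1 + Y) * h^-1 * (1 + Y)^-1.
have hs : rho h *m s *m e = \sum_(Y | level a Y) e *m rho (C Y).
  rewrite mulmx_sumr mulmx_suml; apply: eq_bigr => Y aY.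
  rewrite -rho_M' //; last by apply/stab_G/sK.
  have -> : C Y = h * K Y by rewrite /C /K !mulrA.
  by rewrite (stab_comm S rep) //; apply: (stab_M rep) => //; apply: sK.
have aC Y : level a Y -> level a (C Y - 1).
  move=> aY; have uY := unit1D S aY.
  have -> : C Y - 1 = (h * Y * h^-1 - Y) * (1 + Y)^-1.
    apply: (mulIr uY); rewrite mulrVK // mulrBl mulrVK // mul1r mulrDr mulr1.
    by rewrite mulrDl mulrV //; mx_zmod.
  apply: levelMr; apply: levelB => //.
  by apply: levelMr; apply: levelMl.
(* If [la = 0], the sum of all [e rho (C Z)] vanishes, and so does the sum of its conjugates under
   [1 + w^a M]. By [avg_conj] only the [Z] with [C Z - 1] in the radical survive there, with [om]
   equal to 1 by the choice of [h]; [Z = 0] is one of them, so the count is positive. *)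
have la_neq0 : la != 0.
  apply/eqP => la0; move: hs; rewrite -mulmxA hla la0 scale0r mulmx0 => hs.
  have e0 : \sum_(Y | level a Y) rho (1 + Y) *m
      (\sum_(Z | level a Z) e *m rho (C Z)) *m rho (1 + Y)^-1 = 0.
    by rewrite -hs big1 // => Y _; rewrite mulmx0 mul0mx.
  have e1 : \sum_(Z | level a Z) (Na * (radical x (C Z - 1))%:R) *: e = 0.
    rewrite -[RHS]e0; under [RHS]eq_bigr do rewrite mulmx_sumr mulmx_suml.
    rewrite exchange_big; apply: eq_bigr => Z aZ /=.
    rewrite (eq_bigr (fun Y =>
      e *m rho ((1 + Y) * (1 + (C Z - 1)) * (1 + Y)^-1))) => [|Y aY]; last first.
      have sY := stab_1D S rep x aY; have GY := stab_G sY.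
      rewrite mulmxA -(stab_comm S rep sY) -!mulmxA [1 + (_ - 1)]addrC subrK.
      have GC : G (C Z) by rewrite -[C Z](subrK 1) addrC; apply/(G_1D S rep)/aC.
      have GV := G_V rep GY.
      by rewrite -(rho_M' GC GV) -(rho_M' GY (G_M rep GC GV)) mulrA.
    rewrite avg_conj ?aC //; case: ifP => [rZ|_]; last by rewrite mulr0 scale0r.
    by rewrite (omh Z aZ rZ).
  move: e1; rewrite -scaler_suml -mulr_sumr -natr_sum => /eqP.
  rewrite scaler_eq0 (negPf e_neq0) orbF mulf_eq0 !pnatr_eq0 => /orP[/eqP c0|].
    have : 0 \in [pred Y : M | level a Y] by rewrite inE level0.
    by rewrite (card0_eq c0).
  rewrite (bigD1 0) ?level0 //= (_ : C 0 = 1) ?subrr ?(radical_b S) ?level0 //.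
  by rewrite /C addr0 mulr1 mulrV // invr1 mulr1.
have GC Y : level a Y -> G (C Y).
  by move=> aY; rewrite -[C Y](subrK 1) addrC; apply/(G_1D S rep)/aC.
have Ghg : G (h^-1 * g) by apply: (G_M rep) => //; apply: (G_V rep).
(* [hs] expresses [la *: e rho h] as the sum of the [e rho (C Y)], and each [C Y * (h^-1 * g)] lies
   in [1 + w^a M]. *)
have -> : e *m rho g = la^-1 *: \sum_(Y | level a Y) e *m rho (C Y * (h^-1 * g)).
  under eq_bigr do rewrite rho_M' ?GC // mulmxA.
  rewrite -mulmx_suml -hs -(mulmxA (rho h)) hla -(scalemxAr la) -(stab_comm S rep sh).
  by rewrite -(scalemxAl la) scalerA mulVf // scale1r -mulmxA -rho_M' // mulVKr.
apply/PZ/Psum => Y aY.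
have -> : C Y * (h^-1 * g) = 1 + (C Y * (h^-1 * g) - 1) by rewrite addrC subrK.
apply: P1; have -> : C Y * (h^-1 * g) - 1 =
    (C Y - 1) * (h^-1 * g) + h^-1 * (g - h).
  by rewrite mulrBl mulrBr mulVr // mul1r; mx_zmod.
by apply: levelD; [apply/levelMr/aC | apply: levelMl].
Qed.


End Heisenberg.


(** * Strictly upper triangular matrices against a Hessenberg matrix *)

Section StrictlyUpper.
Variables (R : finComUnitRingType) (l a b : nat) (w : R) (phi : R -> algC).
Hypothesis S : setting l a b w phi.
Variable m : nat.
Local Notation M := 'M[R]_m.+1.
Local Notation level := (@level R l w m).
Local Notation radical := (@radical R l a b w m).
Local Notation tr A := (\tr (A)).
Local Notation e0 := (delta_mx 0 0 : 'cV[R]_m.+1).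
Implicit Types (x y z A Y D N : M).

Lemma supper0 : supper (0 : M).
Proof. by apply/supperP => i j _; rewrite mxE. Qed.

Lemma supperD Y D : supper Y -> supper D -> supper (Y + D).
Proof.
move=> /supperP hY /supperP hD; apply/supperP => i j ij.
by rewrite mxE hY ?hD ?addr0.
Qed.

Lemma supperN Y : supper Y -> supper (- Y).
Proof.
by move=> /supperP hY; apply/supperP => i j ij; rewrite mxE hY ?oppr0.
Qed.

Lemma supperDr Y D : supper D -> supper (Y + D) = supper Y.
Proof.
move=> hD; apply/idP/idP => [h|h]; last exact: supperD.
by rewrite -(addrK D Y); apply/supperD/supperN.
Qed.

Lemma supperMr Y D : supper D -> supper (Y + Y * D) = supper Y.
Proof.
move=> /supperP hD; apply/idP/idP => /supperP hY; apply/supperP; last first.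
  move=> i j ij; rewrite 2!mxE hY // add0r big1 // => k _.
  by case: (leqP k i) => ki; [rewrite hY ?mul0r | rewrite hD ?mulr0 //; lia].
suff h (n : nat) (i j : 'I_m.+1) : (j <= i)%N -> j = n :> nat -> Y i j = 0.
  by move=> i j ij; apply: (h j).
elim/ltn_ind: n i j => n IHn i j ij jn.
have := hY i j ij; rewrite 2!mxE big1 ?addr0 // => k _.
case: (ltnP k j) => kj; last by rewrite hD ?mulr0.
by rewrite (IHn k) ?mul0r //; lia.
Qed.

Lemma supper_delta r (i j : 'I_m.+1) : (j < i)%N -> supper (r *: delta_mx j i : M).
Proof.
move=> ji; apply/supperP => p q pq; rewrite !mxE.
have -> : (p == j) && (q == i) = false; last by rewrite mulr0.
by apply/negP => /andP[/eqP pj /eqP qi]; move: ji pq; rewrite pj qi; lia.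
Qed.

Lemma lower_eq0 A k : (k <= l)%N ->
  (forall Y, supper Y -> level k Y -> phi (tr (A * Y)) = 1) ->
  forall i j : 'I_m.+1, (j < i)%N -> w ^+ k * A i j = 0.
Proof.
move=> kl h i j ji; apply: (phi_nondeg S) => s.
rewrite -(h ((w ^+ k * s) *: delta_mx j i)).
- by rewrite -scalerAr mxtraceZ mxtrace_delta mulrAC.
- exact: supper_delta.
by rewrite -scalerA; exact: (level_w S).
Qed.

Lemma tr_samelow x y Y : samelow x y -> supper Y -> tr (x * Y) = tr (y * Y).
Proof.
move=> h /supperP hY; rewrite /mxtrace; apply: eq_bigr => i _; rewrite !mxE.
apply: eq_bigr => k _; case: (ltnP k i) => ki; first by rewrite h.
by rewrite hY ?mulr0.
Qed.

(** [Y * D] vanishes on the first superdiagonal and [x] below the first subdiagonal. This makes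
    [u |-> phi (tr (x (u - 1)))] multiplicative on [U]. *)
Lemma tr_hess x Y D : hess x -> supper Y -> supper D -> tr (x * (Y * D)) = 0.
Proof.
move=> hx /supperP hY /supperP hD; rewrite /mxtrace big1 // => i _.
rewrite mxE big1 // => k _; case: (ltnP k i) => ki.
  have := hx i k ki; case: eqP => [ik _|_ ->]; last by rewrite mul0r.
  rewrite mxE big1 ?mulr0 // => p _.
  by case: (ltnP k p) => kp; [rewrite hD ?mulr0 //; lia | rewrite hY ?mul0r].
rewrite mxE big1 ?mulr0 // => p _.
by case: (ltnP k p) => kp; [rewrite hD ?mulr0 //; lia | rewrite hY ?mul0r].
Qed.

Lemma supper_e0 Y : supper Y -> Y *m e0 = 0.
Proof.
move=> /supperP h; rewrite -colE; apply/matrixP => i j.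
by rewrite !mxE h.
Qed.

Lemma det_1supper Y : supper Y -> \det (1 + Y) = 1.
Proof.
move=> /supperP h; rewrite -det_tr det_trig.
  by rewrite big1 // => i _; rewrite !mxE h // eqxx addr0.
apply/is_trig_mxP => i j ij; rewrite !mxE h ?addr0; last exact: ltnW.
by rewrite -val_eqE /= gtn_eqF.
Qed.

(** [Y] kills the cyclic vector [e0], and a matrix that also commutes with [x] is then 0; so [U]
    meets the centralizer of [x] trivially at every level. *)
Lemma supper_comm_level k x Y : hess x -> supper Y ->
  level k (x * Y - Y * x) -> level k Y.
Proof.
move=> hx sY h; apply/eqP/(krylov_comm_eq0 (krylov_hess_unit hx)).
  by apply/eqP; rewrite eq_sym -subr_eq0 -scalerAl -scalerAr -scalerBr.
by rewrite -scalemxAl supper_e0 // scaler0.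
Qed.

(** By induction on columns: the unit subdiagonal of [x] lets the entries of column [n.+1] of [A] be
    solved from column [n] of [x * A - A * x]. *)
Lemma supper_of_comm x A : hess x -> A *m e0 = 0 ->
  (forall i j : 'I_m.+1, (j < i)%N -> (x * A - A * x) i j = 0) -> supper A.
Proof.
move=> hx Ae0 h; apply/supperP.
suff main (n : nat) (i j : 'I_m.+1) : (j <= i)%N -> j = n :> nat -> A i j = 0.
  by move=> i j ij; apply: (main j).
elim/ltn_ind: n i j => -[|n] IHn i j ij jn.
  have -> : j = 0 by apply: val_inj.
  by move: Ae0; rewrite -colE => /matrixP/(_ i 0); rewrite !mxE.
have ltn : (n < m.+1)%N by have := ltn_ord j; lia.
have hc : (A * x) i (Ordinal ltn) = (x * A) i (Ordinal ltn).
  have sE (B C : M) p q : (B - C) p q = B p q - C p q by rewrite !mxE.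
  by apply/esym/eqP; rewrite -subr_eq0 -sE h //=; lia.
have xA0 : (x * A) i (Ordinal ltn) = 0.
  rewrite mxE big1 // => k _; case: (ltnP k n) => kn; last first.
    by rewrite (IHn n _ k (Ordinal ltn)) ?mulr0.
  have ki : (k < i)%N by lia.
  have := hx i k ki; case: eqP => [e|_ ->]; last by rewrite mul0r.
  by exfalso; lia.
move: hc; rewrite xA0 mxE (bigD1 j) //= big1 ?addr0 => [|k].
  have := hx j (Ordinal ltn); rewrite /= jn eqxx => /(_ (leqnn _)) u e.
  by apply: (mulIr u); rewrite mul0r.
rewrite -val_eqE /= jn => ne; case: (leqP k n) => kn.
  by rewrite (IHn k) ?mul0r //; lia.
have := hx k (Ordinal ltn) kn; rewrite /= (negPf ne) => ->.
by rewrite mulr0.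
Qed.

End StrictlyUpper.


(** * The Whittaker line in the corner at one [x] *)

Section Whittaker.
Variables (R : finComUnitRingType) (l a b : nat) (w : R) (phi : R -> algC).
Hypothesis S : setting l a b w phi.
Variables (m d : nat) (G : pred 'M[R]_m.+1).
Variable rho : 'M[R]_m.+1 -> 'M[algC]_d.
Hypothesis rep : matrep l w G rho.
Local Notation M := 'M[R]_m.+1.
Local Notation level := (@level R l w m).
Local Notation radical := (@radical R l a b w m).
Local Notation stab := (@stab R l a w m G).
Local Notation eid := (@eid R l b w phi m d rho).
Local Notation tr A := (\tr (A)).
Local Notation e0 := (delta_mx 0 0 : 'cV[R]_m.+1).
Implicit Types (x y g Y D N : M) (v : 'rV[algC]_d).

Let lE : l = (a + b)%N := l_split S.
Let ab : (a <= b)%N := le_a_b S.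
Let b2a : (b <= a.*2)%N := le_b_2a S.
Let rho_M' := rho_M rep.

(* The case [i = 0] is a Whittaker vector for the whole of [U]. *)
Definition whit (i : nat) x v := forall Y, supper Y -> level i Y ->
  v *m rho (1 + Y) = phi (tr (x * Y)) *: v.

(** For Hessenberg [x], the projector onto the row vectors of [whit i x], up to the factor in
    [whit_mul_sum]. *)
Definition whit_sum (i : nat) x : 'M[algC]_d :=
  \sum_(Y : M | supper Y && level i Y) phi (- tr (x * Y)) *: rho (1 + Y).

Lemma level_0 Y : level 0 Y.
Proof. by rewrite /level subn0 (w_l S) scale0r. Qed.

Lemma G_1supper Y : supper Y -> G (1 + Y).
Proof. by move=> h; apply/(G_SL rep)/det_1supper. Qed.

Lemma unit_1supper Y : supper Y -> 1 + Y \is a GRing.unit.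
Proof. by move/G_1supper/(G_unit rep). Qed.

Lemma whit_samelow i x y v : samelow x y -> whit i x v -> whit i y v.
Proof. by move=> h hv Y sY iY; rewrite hv // (tr_samelow h sY). Qed.

Lemma whitD i x u v : whit i x u -> whit i x v -> whit i x (u + v).
Proof. by move=> hu hv Y sY iY; rewrite mulmxDl hu // hv // scalerDr. Qed.

Lemma whitZ i x c v : whit i x v -> whit i x (c *: v).
Proof. by move=> hv Y sY iY; rewrite -scalemxAl hv // !scalerA mulrC. Qed.

Lemma whit_sum_r i x Y : hess x -> supper Y -> level i Y ->
  whit_sum i x *m rho (1 + Y) = phi (tr (x * Y)) *: whit_sum i x.
Proof.
move=> hx sY iY; have uY := unit_1supper sY.
rewrite mulmx_suml scaler_sumr.
(* Right translation by [1 + Y] on [U], written in terms of [Z]. *)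
rewrite [RHS](reindex (fun Z => Z * (1 + Y) + Y)) /=; last first.
  by exists (fun Z => (Z - Y) * (1 + Y)^-1) => Z _;
    rewrite ?addrK ?mulrVK ?mulrK ?subrK.
have ZE Z : Z * (1 + Y) + Y = (Z + Z * Y) + Y by rewrite mulrDr mulr1.
apply: eq_big => Z.
  rewrite {1}ZE supperDr // supperMr //; congr (_ && _).
  by rewrite levelDr // levelMu.
case/andP=> sZ iZ; rewrite -scalemxAl scalerA -rho_M' ?G_1supper // -(phi_D S).
congr (phi _ *: rho _).
  rewrite ZE !mulrDr !mxtraceD tr_hess // addr0; ring.
by rewrite mulrDl mul1r; mx_zmod.
Qed.

Lemma whit_mul_sum i x v : whit i x v ->
  v *m whit_sum i x = #|[pred Y : M | supper Y && level i Y]|%:R *: v.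
Proof.
move=> hv; rewrite mulmx_sumr (eq_bigr (fun=> v)) => [|Y /andP[sY iY]].
  by rewrite sumr_const scaler_nat.
by rewrite -scalemxAr hv // scalerA -(phi_D S) addNr (phi_0 S) scale1r.
Qed.

Lemma whit_card_neq0 i :
  #|[pred Y : M | supper Y && level i Y]|%:R != 0 :> algC.
Proof.
rewrite pnatr_eq0 -lt0n; apply/card_gt0P; exists 0.
by rewrite inE supper0 level0.
Qed.

(** Maximality of the polarization: it contains its own orthogonal. Up to a polynomial in [x], which
    belongs to the radical, [Y] can be made to kill [e0], and [supper_of_comm] then makes it
    strictly upper triangular modulo [w^b]. *)
Lemma polarization x Y : hess x -> level a Y ->
  (forall D, supper D -> level a D -> phi (tr ((x * Y - Y * x) * D)) = 1) ->
  exists u z, [/\ supper u, level a u, radical x z & 1 + Y = (1 + u) * (1 + z)].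
Proof.
move=> hx aY hY; have ux := krylov_hess_unit hx.
have al : (a <= l)%N by lia.
have low := lower_eq0 S al hY.
have [y Yy] := levelP S al aY.
(* The polynomial with coefficients [c] agrees with [y] at [e0], so [z] kills [e0]. *)
pose c := invmx (@krylov m.+1 R x e0) *m (y *m e0).
pose z := w ^+ a *: (y - polm x c).
have xp : x * polm x c = polm x c * x by exact: polm_comm.
have comm_z : x * z - z * x = x * Y - Y * x.
  rewrite /z Yy -!scalerAr -!scalerAl -!scalerBr mulrBr mulrBl xp.
  by congr (_ *: _); mx_zmod.
have sz : supper (w ^+ a *: z).
  apply: (supper_of_comm hx).
    by rewrite -!scalemxAl mulmxBl polm_cyclic // subrr !scaler0.
  move=> i j ji; rewrite -scalerAr -scalerAl -scalerBr comm_z mxE.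
  exact: low.
(* The part of [z] on and below the diagonal is killed by [w ^+ a], so it lies in [w^b M] and may be
   dropped. *)
pose u : M := \matrix_(i, j) (if (i < j)%N then z i j else 0).
have su : supper u by apply/supperP => i j ij; rewrite mxE ltnNge ij.
have au : level a u.
  have /eqP az : level a z by exact: (level_w S).
  apply/eqP/matrixP => i j; have /matrixP/(_ i j) := az; rewrite !mxE.
  by case: ifP => // _; rewrite mulr0.
have bzu : level b (z - u).
  have /supperP h := sz; apply/eqP/matrixP => i j.
  rewrite (_ : l - b = a)%N; last by lia.
  rewrite [LHS]mxE [(z - u) i j]mxE [(- u) i j]mxE [u i j]mxE [RHS]mxE.
  case: ltnP => ij; first by rewrite subrr mulr0.
  by have := h i j ij; rewrite mxE subr0.
have uu := unit1D S au.
pose n := (1 + u)^-1 * (1 + Y) - 1.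
exists u, n; split=> //; last first.
  by rewrite /n addrCA subrr addr0 mulVKr.
have -> : n = w ^+ a *: polm x c + ((z - u) - (1 + u)^-1 * (u * (Y - u))).
  have YE : Y = w ^+ a *: polm x c + z by rewrite /z scalerBr Yy addrCA subrr addr0.
  have nE : n = (1 + u)^-1 * (Y - u).
    have -> : Y - u = (1 + Y) - (1 + u) by mx_zmod.
    by rewrite mulrBr mulVr.
  rewrite nE.
  have -> : (1 + u)^-1 * (Y - u) = (Y - u) - (1 + u)^-1 * (u * (Y - u)).
    apply: (mulrI uu); rewrite mulVKr // mulrBr mulVKr // mulrDl mul1r.
    by rewrite addrK.
  by rewrite {1}YE; mx_zmod.
rewrite (radicalDb S); last first.
  apply: levelB => //; apply/levelMl/(level_aa S) => //; exact: levelB.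
rewrite /radical (level_w S) /= -scalerAr -scalerAl xp subrr level0 //.
Qed.

(** [whit_sum a x] sends the orbit of [u] under [1 + w^a M] back to the line of [u]: if [Y] pairs
    nontrivially with [U] the sum vanishes, and otherwise [polarization] factors [1 + Y] into two
    elements scaling [u]. [corner_ind] extends this to the whole corner, which carries [u] to
    [v]. *)
Lemma chi_unique x u v : hess x -> u *m eid x = u -> v *m eid x = v ->
  whit a x u -> whit a x v -> u != 0 -> exists c, v = c *: u.
Proof.
move=> hx ue ve wu wv u0; have ux := krylov_hess_unit hx.
have e_neq0 : eid x != 0.
  by apply: contraNneq u0 => e0; rewrite -ue e0 mulmx0.
have [om omE] := exists_omega S rep ux e_neq0.
have step Y : level a Y -> exists r, u *m rho (1 + Y) *m whit_sum a x = r *: u.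
  move=> aY; have GY := G_1D S rep aY.
  have term D : supper D -> level a D ->
      u *m rho (1 + Y) *m (phi (- tr (x * D)) *: rho (1 + D)) =
      phi (tr ((x * Y - Y * x) * D)) *: (u *m rho (1 + Y)).
    move=> sD aD; have GD := G_1D S rep aD.
    have bc : level b (Y * D - D * Y) by apply: levelB; apply: (level_aa S).
    have uY := unit1D S aY.
    rewrite -scalemxAr -mulmxA -rho_M' //.
    have -> : (1 + Y) * (1 + D) = (1 + (Y * D - D * Y)) * ((1 + D) * (1 + Y)).
      by rewrite [RHS]mulrA -(conj_1D S) // mulrVK.
    rewrite rho_M' ?(G_1Db S rep) ?(G_M rep) // mulmxA -{1}ue -(mulmxA u).
    rewrite (eid_r S rep) // -(scalemxAr (phi _) u) ue -scalemxAl.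
    rewrite rho_M' // mulmxA (wu D) // -(scalemxAl _ u) !scalerA.
    rewrite mulrAC [_ * phi (tr (x * D))]mulrC -(phi_D S) subrr (phi_0 S) mul1r.
    congr (phi _ *: _); rewrite mulrBr mulrBl !mxtraceBE !mulrA.
    by congr (_ - _); rewrite mxtraceC mulrA.
  rewrite /whit_sum mulmx_sumr.
  rewrite (eq_bigr (fun D => phi (tr ((x * Y - Y * x) * D)) *: (u *m rho (1 + Y)))).
    rewrite -scaler_suml.
    have [/existsP[D /and3P[sD aD nD]]|none] := boolP [exists D : M,
        [&& supper D, level a D & phi (tr ((x * Y - Y * x) * D)) != 1]].
      exists 0; rewrite scale0r (sum_char_eq0 (B := D)) ?scale0r // => [N|N _].
        by rewrite supperDr // levelDr.
      by rewrite mulrDr mxtraceD (phi_D S).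
    have [|n [z [sn an rz ->]]] := polarization hx aY.
      move=> D sD aD; apply/eqP; have /existsPn/(_ D) := none.
      by rewrite sD aD negbK.
    have az : level a z by case/andP: rz.
    rewrite rho_M' ?(G_1D S rep) // mulmxA wu // -(scalemxAl (phi _) u).
    by rewrite -{1}ue -mulmxA omE // -(scalemxAr (om z)) ue !scalerA; eexists.
  by move=> D /andP[sD aD]; rewrite term.
pose P X := exists r, u *m X *m whit_sum a x = r *: u.
have PE X : P (eid x *m X *m eid x).
  apply: (corner_ind S rep ux e_neq0 omE).
  - move=> X1 X2 [r1 h1] [r2 h2]; exists (r1 + r2).
    by rewrite mulmxDr mulmxDl h1 h2 scalerDl.
  - move=> r X1 [r1 h1]; exists (r * r1).
    by rewrite -scalemxAr -scalemxAl h1 scalerA.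
  by move=> Y aY; have [r hr] := step Y aY; exists r; rewrite mulmxA ue.
have /rV0Pn[j uj] := u0.
(* A rank-one matrix sending [u] to [v]; passing to its corner keeps this, as [eid x] fixes both
   vectors. *)
have [r] := PE ((u 0 j)^-1 *: (delta_mx j 0 *m v)).
have -> : u *m (eid x *m ((u 0 j)^-1 *: (delta_mx j 0 *m v)) *m eid x) = v.
  rewrite !mulmxA ue -(scalemxAr (u 0 j)^-1) mulmxA -colE.
  have -> : col j u = (u 0 j)%:M by apply/matrixP => p q; rewrite !mxE !ord1 eqxx.
  by rewrite mul_scalar_mx scalerA mulVf // scale1r ve.
rewrite whit_mul_sum // => h; exists (#|[pred Y : M | supper Y && level a Y]|%:R^-1 * r).
by rewrite -scalerA -h scalerA mulVf ?scale1r // whit_card_neq0.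
Qed.

End Whittaker.


(** * Existence and uniqueness of Whittaker vectors for [U] *)

Section WhittakerModels.
Variables (R : finComUnitRingType) (l a b : nat) (w : R) (phi : R -> algC).
Hypothesis S : setting l a b w phi.
Variables (m d : nat) (G : pred 'M[R]_m.+1).
Variable rho : 'M[R]_m.+1 -> 'M[algC]_d.
Hypothesis rep : matrep l w G rho.
Local Notation M := 'M[R]_m.+1.
Local Notation level := (@level R l w m).
Local Notation radical := (@radical R l a b w m).
Local Notation stab := (@stab R l a w m G).
Local Notation eid := (@eid R l b w phi m d rho).
Local Notation whit := (@whit R l w phi m d rho).
Local Notation whit_sum := (@whit_sum R l w phi m d rho).
Local Notation tr A := (\tr (A)).
Local Notation e0 := (delta_mx 0 0 : 'cV[R]_m.+1).
Implicit Types (x y g Y D N : M) (v : 'rV[algC]_d).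

Let lE : l = (a + b)%N := l_split S.
Let ab : (a <= b)%N := le_a_b S.
Let b2a : (b <= a.*2)%N := le_b_2a S.
Let rho_M' := rho_M rep.

Lemma row_neq0 (X : 'M[algC]_d) : X != 0 -> exists i, row i X != 0.
Proof.
case/matrix0Pn => i [j nz]; exists i; apply/rV0Pn; exists j.
by rewrite mxE.
Qed.

(** It is enough that [eid x *m whit_sum a x] is nonzero. Summing its conjugates under [1 + w^a M]
    keeps the [D] in the radical; these lie in [w^b M], where [om] cancels the character, so the
    result is a positive multiple of [eid x]. *)
Lemma chi_exists x : hess x -> eid x != 0 ->
  exists v, [/\ v != 0, v *m eid x = v & whit a x v].
Proof.
move=> hx e_neq0; have ux := krylov_hess_unit hx.
have [om omE] := exists_omega S rep ux e_neq0.
have nz : eid x *m whit_sum a x != 0.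
  apply/eqP => z.
  have : \sum_(Y | level a Y) rho (1 + Y) *m (eid x *m whit_sum a x) *m rho (1 + Y)^-1 = 0.
    by rewrite big1 // => Y _; rewrite z mulmx0 mul0mx.
  have -> : \sum_(Y | level a Y)
      rho (1 + Y) *m (eid x *m whit_sum a x) *m rho (1 + Y)^-1 =
    \sum_(D : M | supper D && level a D)
      (@Na R l a w m * (radical x D)%:R) *: eid x.
    rewrite /whit_sum; under eq_bigr do rewrite mulmx_sumr mulmx_sumr mulmx_suml.
    rewrite exchange_big /=; apply: eq_bigr => D /andP[sD aD].
    have GD := G_1D S rep aD.
    rewrite (eq_bigr (fun Y => phi (- tr (x * D)) *: (eid x *m
        rho ((1 + Y) * (1 + D) * (1 + Y)^-1)))) => [|Y aY].
      rewrite -scaler_sumr (avg_conj S rep ux e_neq0 omE aD).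
      case: ifP => rD; last by rewrite scaler0 mulr0 scale0r.
      rewrite mulr1 scalerA mulrCA (om_b S rep e_neq0 omE).
        by rewrite -(phi_D S) addNr (phi_0 S) mulr1.
      by apply: (supper_comm_level hx sD); case/andP: rD.
    have sY := stab_1D S rep x aY; have GY := stab_G sY.
    have GV := G_V rep GY.
    rewrite -(scalemxAr (phi _)) -(scalemxAr (phi _)) -(scalemxAl (phi _)).
    congr (_ *: _); rewrite mulmxA -(stab_comm S rep sY) -!mulmxA.
    by rewrite -(rho_M' GD GV) -(rho_M' GY (G_M rep GD GV)) mulrA.
  rewrite -scaler_suml -mulr_sumr -natr_sum => /eqP.
  rewrite scaler_eq0 (negPf e_neq0) orbF mulf_eq0 !pnatr_eq0 => /orP[/eqP c0|].
    have : 0 \in [pred Y : M | level a Y] by rewrite inE level0.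
    by rewrite (card0_eq c0).
  by rewrite (bigD1 0) ?supper0 ?level0 //= (radical_b S) ?level0.
have es : eid x *m whit_sum a x = whit_sum a x *m eid x.
  rewrite mulmx_sumr mulmx_suml; apply: eq_bigr => Y /andP[_ aY].
  rewrite -(scalemxAr (phi _)) -(scalemxAl (phi _)).
  by rewrite (stab_comm S rep (stab_1D S rep x aY)).
have [i ni] := row_neq0 nz; exists (row i (eid x *m whit_sum a x)); split=> //.
  by rewrite -row_mul -mulmxA -es mulmxA (eid_idem S rep).
move=> Y sY aY; rewrite -row_mul -mulmxA (whit_sum_r S rep) //.
by rewrite -(scalemxAr (phi _)); apply/rowP => j; rewrite !mxE.
Qed.

(** Sum a vector of [chi_exists] over [U] and take the component at [x]: terms outside the
    stabilizer vanish, and those inside have [Y] in [w^a M] and each give back [v], so nothing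
    cancels. *)
Lemma whit_exists x : hess x -> eid x != 0 ->
  exists2 v, v != 0 & whit 0 x v.
Proof.
move=> hx /(chi_exists hx)[v [nv ve wv]]; exists (v *m whit_sum 0 x); last first.
  by move=> Y sY _; rewrite -mulmxA (whit_sum_r S rep) ?(level_0 S) // scalemxAr.
suff h : v *m whit_sum 0 x *m eid x =
    #|[pred Y : M | supper Y && level a Y]|%:R *: v.
  apply: contraNneq nv => z; move/eqP: h; rewrite z mul0mx eq_sym scaler_eq0.
  by rewrite (negPf (whit_card_neq0 l w m a)).
rewrite -mulmxA mulmx_suml mulmx_sumr (bigID (level a)) /= [X in _ + X]big1.
  rewrite addr0 scaler_nat -sumr_const; apply: eq_big => [Y|Y].
    by rewrite (level_0 S) andbT.
  case/andP=> /andP[sY _] aY; rewrite -(scalemxAl (phi _)) -(scalemxAr (phi _)).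
  rewrite mulmxA wv // -(scalemxAl _ v) ve scalerA -(phi_D S) addNr (phi_0 S).
  by rewrite scale1r.
move=> Y /andP[/andP[sY _] nY].
rewrite -(scalemxAl (phi _)) -(scalemxAr (phi _)) -{1}ve -mulmxA [eid x *m _]mulmxA.
rewrite (stab_off S rep) ?mulmx0 ?scaler0 //; first exact: (G_1supper rep).
apply: contra nY => /andP[_]; rewrite mulrDr mulrDl mulr1 mul1r => h.
apply: (supper_comm_level hx sY); move: h; congr (is_true (level a _)).
by mx_zmod.
Qed.

Lemma whit_unit_conj x y u v : u \is a GRing.unit -> supper (u - 1) ->
  whit 0 x v -> v *m eid x = 0 -> v *m eid (u * x * u^-1) = 0.
Proof.
move=> uu su wv ve; have Gu : G u.
  by rewrite -[u](subrK 1) addrC (G_1supper rep).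
have e : eid (u * x * u^-1) *m rho u = rho u *m eid x.
  by rewrite (eid_conj S rep) // !mulrA mulVr // mul1r mulrVK.
have -> : eid (u * x * u^-1) = rho u *m eid x *m rho u^-1.
  by rewrite -e -mulmxA (rhoK rep) // mulmx1.
have -> : u = 1 + (u - 1) by rewrite addrC subrK.
by rewrite 2!mulmxA wv ?(level_0 S) // -(scalemxAl _ v) ve scaler0 mul0mx.
Qed.

Lemma eid_support v : v != 0 -> exists y, v *m eid y != 0.
Proof.
move=> nv; apply/existsP; apply: contraNT nv => /existsPn h.
have [c nc ec] := sum_eid S rep.
have : v *m \sum_y eid y = 0.
  by rewrite mulmx_sumr big1 // => y _; apply/eqP; have := h y; rewrite negbK.
by rewrite ec mul_mx_scalar => /eqP; rewrite scaler_eq0 (negPf nc).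
Qed.

(** On [U] intersected with [1 + w^b M] the vector and its component at [y] have the same
    eigencharacter, so [x] and [y] agree below the diagonal modulo [w^a]. *)
Lemma whit_support x y v : whit 0 x v -> v *m eid y != 0 ->
  exists2 z, samelow x z & level a (y - z).
Proof.
move=> wv ny.
have low : forall i j : 'I_m.+1, (j < i)%N -> w ^+ b * (y - x) i j = 0.
  apply: (lower_eq0 S); first by lia.
  move=> Y sY bY; have : (phi (tr (y * Y)) - phi (tr (x * Y))) *: (v *m eid y) = 0.
    rewrite scalerBl; apply/eqP; rewrite subr_eq0; apply/eqP.
    rewrite (scalemxAr (phi _) v) -(eid_l S rep y bY) mulmxA.
    by rewrite wv ?(level_0 S) // -(scalemxAl _ v).
  move/eqP; rewrite scaler_eq0 (negPf ny) orbF subr_eq0 => /eqP e.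
  by rewrite mulrBl mxtraceBE (phi_D S) e -(phi_D S) subrr (phi_0 S).
exists (\matrix_(i, j) if (j < i)%N then x i j else y i j).
  by move=> i j ji; rewrite mxE ji.
apply/eqP/matrixP => i j; rewrite (_ : l - a = b)%N; last by lia.
have := low i j; rewrite !mxE; case: ifP => [_ -> //|_ _].
by rewrite subrr mulr0.
Qed.

(* Two Hessenberg characters of one irreducible representation that agree
   below the diagonal are conjugate under [U]. *)
Lemma whit_unique x u v : hess x -> whit 0 x u -> whit 0 x v -> u != 0 ->
  exists c, v = c *: u.
Proof.
move=> hx wu wv nu; have [y ny] := eid_support nu.
have [z xz yz] := whit_support wu ny.
rewrite (eid_eq S rho yz) in ny.
have hz := samelow_hess xz hx.
have wzu := whit_samelow xz wu; have wzv := whit_samelow xz wv.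
have chi t : whit 0 z t -> (t *m eid z) *m eid z = t *m eid z /\ whit a z (t *m eid z).
  move=> wt; split=> [|Y sY aY]; first by rewrite -mulmxA (eid_idem S rep).
  rewrite -mulmxA (stab_comm S rep (stab_1D S rep z aY)) mulmxA.
  by rewrite wt ?(level_0 S) // -(scalemxAl _ t).
have [ue cu] := chi _ wzu; have [ve cv] := chi _ wzv.
have [c hc] := chi_unique S rep hz ue ve cu cv ny.
(* [t] is a Whittaker vector without component at [z]; every other possible component is carried to
   that one by [U], so [t = 0]. *)
exists c; pose t := v - c *: u.
have wt : whit 0 z t by rewrite /t -scaleNr; apply: whitD => //; apply: whitZ.
have te : t *m eid z = 0.
  by rewrite mulmxBl hc -(scalemxAl _ u) subrr.
apply/eqP; rewrite -subr_eq0 -/t; apply/negPn/negP => /eid_support[y' ny'].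
have [z' zz' yz'] := whit_support wt ny'.
rewrite (eid_eq S rho yz') in ny'.
(* Irreducibility: if no [g] conjugated [z] to [z'] modulo [w^a], then [eid z *m X *m eid z'] would
   vanish for every [X]. *)
have [g Gg hg] : exists2 g, G g & level a (g^-1 * z * g - z').
  have nz : eid z != 0 by apply: contraNneq ny => e; rewrite e mulmx0.
  have nz' : eid z' != 0 by apply: contraNneq ny' => e; rewrite e mulmx0.
  have [/existsP[g /andP[Gg hg]]|none] :=
    boolP [exists g, G g && level a (g^-1 * z * g - z')]; first by exists g.
  have all0 X : eid z *m X *m eid z' = 0.
    have [co ->] := rho_span rep X.
    rewrite mulmx_sumr mulmx_suml big1 // => g Gg.
    rewrite -(scalemxAr (co g)) -(scalemxAl (co g)) (eid_conj S rep) //.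
    rewrite -mulmxA (eid_M S rep).
    have /existsPn/(_ g) := none; rewrite Gg /= => /negPf ->.
    by rewrite mulmx0 scaler0.
  have /matrix0Pn[p [q n1]] := nz; have /matrix0Pn[i [j n2]] := nz'.
  have /matrixP/(_ p j) := all0 (delta_mx q i).
  rewrite mul_delta_mxE [RHS]mxE => /eqP; rewrite mulf_eq0.
  by rewrite (negPf n1) (negPf n2).
have ug := G_unit rep Gg.
have ugV : g^-1 \is a GRing.unit by rewrite unitrV.
have hgV : level a (z' - g^-1 * z * g^-1^-1) by rewrite invrK levelBC.
(* The conjugating element is replaced by one of [U], for which [t] is an eigenvector. *)
have [n [un sn an]] := hess_conj hz zz' ugV hgV.
move/negP: ny'; apply; apply/eqP.
rewrite (eid_eq S rho an).
by rewrite (whit_unit_conj z' un sn).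
Qed.

End WhittakerModels.


(** * Arithmetic of the finite quotient ring *)

Section Oell.
Variables (R : finComUnitRingType) (l : nat) (w : R).
Hypotheses (l2 : (2 <= l)%N) (Rw : oell l w).

Lemma oell_nilp : w ^+ l = 0.
Proof.
have [O [v [f [_ _ _ ker <-]]]] := Rw.
by rewrite -rmorphXn; apply/ker; exists 1; rewrite mul1r.
Qed.

Lemma oell_unitX (r : R) : r != 0 ->
  exists u k, [/\ u \is a GRing.unit, (k < l)%N & r = u * w ^+ k].
Proof.
have [O [v [f [v0 fact sur ker fv]]]] := Rw; move=> r0.
have [y yr] := sur r; have y0 : y != 0.
  by apply: contraNneq r0 => y0; rewrite -yr y0 rmorph0.
have [u [k [uu yE]]] := fact y y0; exists (f u), k.
have rE : r = f u * w ^+ k by rewrite -yr yE rmorphM rmorphXn /= fv.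
split=> //; first exact: rmorph_unit.
rewrite ltnNge; apply: contra r0 => lk.
by rewrite rE -(subnK lk) exprD oell_nilp !mulr0.
Qed.

Lemma oell_wX k : (k < l)%N -> w ^+ k != 0.
Proof.
have [O [v [f [[v0 vu] fact sur ker fv]]]] := Rw; move=> kl; apply/negP => /eqP wk0.
have : f (v ^+ k) = 0 by rewrite rmorphXn /= fv.
case/ker => c vk; case/negP: vu.
have vk0 : v ^+ k != 0 by rewrite expf_neq0.
have e : 1 = c * v ^+ (l - k).
  by apply: (mulIf vk0); rewrite mul1r -mulrA -exprD subnK // ltnW.
apply/unitrP; exists (c * v ^+ (l - k).-1).
rewrite [v * _]mulrC -mulrA -exprSr prednK; first by rewrite -e.
by rewrite subn_gt0.
Qed.

Lemma oell_setting phi : additive_char phi -> primitive_addchar l w phi ->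
  setting l l./2 (l - l./2) w phi.
Proof.
case=> phi0 phiD [a0 na0]; have hl := odd_double_half l.
have nw : w \notin GRing.unit.
  apply/negP => uw; have := unitrX l uw.
  by rewrite oell_nilp unitr0.
split=> //; try by move: hl; rewrite -addnn; case: odd => /=; lia.
- exact: oell_nilp.
- move=> i r il wr; have [->|r0] := eqVneq r 0; first by exists 0; rewrite mulr0.
  have [u [k [uu kl rE]]] := oell_unitX r0.
  have ik : (i <= k)%N.
    rewrite leqNgt; apply/negP => ki.
    have /oell_wX/negP : (l - i + k < l)%N by lia.
    case; rewrite exprD; apply/eqP/(mulrI uu); rewrite mulr0 -wr rE.
    by rewrite mulrCA.
  by exists (u * w ^+ (k - i)); rewrite rE -{1}(subnK ik) exprD; ring.
- move=> r nr; have [->|r0] := eqVneq r 0; first by exists 0; rewrite mulr0.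
  have [u [[|k] [uu kl rE]]] := oell_unitX r0.
    by move: nr; rewrite rE expr0 mulr1 uu.
  by exists (u * w ^+ k); rewrite rE exprS; ring.
move=> r hr; apply/eqP/negPn/negP => r0; case/negP: na0; apply/eqP.
have [u [k [uu kl rE]]] := oell_unitX r0.
(* This multiplier turns [r = u * w ^+ k] into [w ^+ l.-1 * a0], where [phi] is nontrivial by
   primitivity. *)
rewrite -[RHS](hr (u^-1 * w ^+ (l.-1 - k) * a0)) rE; congr phi.
rewrite mulrACA -mulrA [in RHS]mulrA mulrA; rewrite (_ : l.-1 = k + (l.-1 - k))%N; last by lia.
by rewrite addKn exprD; rewrite -[LHS]mul1r -(mulrV uu); ring.
Qed.

End Oell.

(** * Self-duality of the additive group of [R] *)

Section Duality.
Variables (R : finComUnitRingType) (l a b : nat) (w : R) (phi : R -> algC).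
Hypothesis S : setting l a b w phi.

Lemma sum_phi (r : R) : \sum_c phi (r * c) = if r == 0 then #|{: R}|%:R else 0.
Proof.
case: eqP => [->|nz].
  by rewrite (eq_bigr (fun=> 1)) ?sumr_const // => c _; rewrite mul0r (phi_0 S).
suff /existsP[c nc] : [exists c, phi (r * c) != 1].
  by apply: (@sum_char_eq0 _ _ _ c) => // s _; rewrite mulrDr (phi_D S).
apply/existsPn => h; apply/nz/(phi_nondeg S) => c.
by apply/eqP; have := h c; rewrite negbK.
Qed.

(** The Fourier coefficients of [psi] cannot all vanish, since they add up to the number of elements
    of [R]; a nonzero one at [c] forces [psi] to be the character of [c]. *)
Lemma additive_charE psi : additive_char psi -> exists c, forall r, psi r = phi (c * r).
Proof.
case=> psi0 psiD.
have [c nc] : exists c, \sum_r psi r * phi (- (c * r)) != 0.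
  apply/existsP/existsPn => h.
  have : \sum_c \sum_r psi r * phi (- (c * r)) = 0.
    by apply: big1 => c _; apply/eqP; have := h c; rewrite negbK.
  rewrite exchange_big (bigD1 0) //= [X in _ + X]big1 => [|r nr].
    rewrite addr0 -mulr_sumr psi0 mul1r (eq_bigr (fun=> 1)) => [|c _].
      rewrite sumr_const => /eqP; rewrite pnatr_eq0 => /eqP/card0_eq/(_ 0).
      by rewrite inE.
    by rewrite mulr0 oppr0 (phi_0 S).
  rewrite -mulr_sumr (eq_bigr (fun c => phi (- r * c))) => [|c _].
    by rewrite sum_phi oppr_eq0 (negPf nr) mulr0.
  by rewrite mulrC mulNr.
exists c => r; apply/eqP; apply: contraNT nc => ne; apply/eqP.
apply: (@sum_char_eq0 _ _ _ r) => // [s _|].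
  by rewrite psiD mulrDr opprD (phi_D S); ring.
apply: contra ne => /eqP e; apply/eqP.
by rewrite -[LHS](mulfK (phi_neq0 S (- (c * r)))) e mul1r (phi_N S) invrK.
Qed.

Lemma primitive_unit c : primitive_addchar l w (fun r => phi (c * r)) <->
  c \is a GRing.unit.
Proof.
have l0 : (0 < l)%N by rewrite (l_split S) addn_gt0 (a_gt0 S).
split=> [[r nr]|uc].
  apply: contraNT nr => /(nunit_w S)[s ->].
  have wl : w * w ^+ l.-1 = 0 by rewrite -exprS prednK ?(w_l S).
  have -> : w * s * (w ^+ l.-1 * r) = w * w ^+ l.-1 * (s * r) by ring.
  by rewrite wl mul0r (phi_0 S).
apply/existsP; rewrite -[[exists _, _]]negbK; apply/negP => /existsPn h.
have z : c * w ^+ l.-1 = 0.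
  apply: (phi_nondeg S) => s; rewrite -mulrA; apply/eqP.
  by have := h s; rewrite negbK.
have [|s ws] := w_ann S (i := 1) (r := 1) l0.
  by rewrite mulr1 subn1; apply: (mulrI uc); rewrite z mulr0.
by case/negP: (w_nunit S); apply/unitrP; exists s; rewrite mulrC -ws.
Qed.

Variable m : nat.
Local Notation M := 'M[R]_m.+1.

Lemma phi_sum (I : finType) (F : I -> R) :
  phi (\sum_i F i) = \prod_i phi (F i).
Proof. by apply: (big_morph phi (phi_D S) (phi_0 S)). Qed.

Lemma tr_hess_sub (x D : M) : hess x -> supper D ->
  \tr (x * D) = \sum_(i < m) x (inord i.+1) (inord i) * D (inord i) (inord i.+1).
Proof.
move=> hx /supperP hD; rewrite mxtraceC /mxtrace big_ord_recr /= [X in _ + X]mxE.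
rewrite [X in _ + X]big1 ?addr0 => [|k _]; last by rewrite hD ?mul0r // -ltnS.
apply: eq_bigr => i _; rewrite mxE.
have i1 : inord i = widen_ord (leqnSn m) i by apply: val_inj; rewrite /= inordK // ltnS ltnW.
rewrite (bigD1 (inord i.+1)) //= big1 ?addr0 => [|k]; first by rewrite i1 mulrC.
rewrite -val_eqE /= inordK ?ltnS // => nk.
case: (ltnP i k) => ik; last by rewrite hD ?mul0r.
have := hx k (widen_ord (leqnSn m) i) ik; rewrite /= (negPf nk) => ->.
by rewrite mulr0.
Qed.

End Duality.

(** * Multiplicities of linear characters as ranks of projectors *)

Section Projectors.
Variables (gT : finGroupType) (G H : {group gT}) (i : Iirr G).
Hypothesis sHG : H \subset G.
Local Notation rG := ('Chi_i).
Variable psi : 'CF(H).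
Hypothesis psiM : {in H &, forall g h, psi (g * h)%g = psi g * psi h}.
Hypothesis psi_conj : {in H, forall g, (psi g)^* = psi g^-1%g}.
Hypothesis psi1 : psi 1%g = 1.

Definition proj_mx := (#|H|%:R^-1 : algC) *: \sum_(h in H) (psi h)^* *: rG h.

Lemma cfdot_proj : '['Res[H] 'chi_i, psi] = \tr proj_mx.
Proof.
rewrite cfdotE mxtraceZ raddf_sum; congr (_ * _); apply: eq_bigr => h Hh.
by rewrite /= mxtraceZ cfResE // -irrRepr cfunE (subsetP sHG) // mulr1n mulrC.
Qed.

Lemma proj_mx_r h : h \in H -> proj_mx *m rG h = psi h *: proj_mx.
Proof.
move=> Hh; rewrite -scalemxAl scalerA mulrC -scalerA; congr (_ *: _).
rewrite mulmx_suml scaler_sumr [RHS](reindex_inj (mulIg h)) /=.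
apply: eq_big => [g|g Hg]; first by rewrite groupMr.
rewrite -scalemxAl scalerA repr_mxM ?(subsetP sHG) //; congr (_ *: _).
rewrite !psi_conj ?groupM // invMg psiM ?groupV // mulrA -psiM ?groupV //.
by rewrite mulgV psi1 mul1r.
Qed.

Lemma proj_mx_id (v : 'rV_(irr_degree (socle_of_Iirr i))) :
  (forall h, h \in H -> v *m rG h = psi h *: v) -> v *m proj_mx = v.
Proof.
move=> hv; rewrite -scalemxAr mulmx_sumr (eq_bigr (fun=> v)) => [|h Hh].
  rewrite sumr_const -scaler_nat scalerA mulVf ?scale1r //.
  by rewrite pnatr_eq0 -lt0n cardG_gt0.
rewrite -scalemxAr hv // scalerA psi_conj // -psiM ?groupV // mulVg psi1.
by rewrite scale1r.
Qed.

Lemma proj_mx_idem : proj_mx *m proj_mx = proj_mx.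
Proof.
apply/row_matrixP => j; rewrite row_mul; apply: proj_mx_id => h Hh.
by rewrite -row_mul proj_mx_r //; apply/rowP => k; rewrite !mxE.
Qed.

(** In the full-rank factorization of [E], idempotence forces the product in the reverse order to be
    the identity of size [\rank E]. *)
Lemma idem_trace (F : fieldType) d (E : 'M[F]_d) : E *m E = E ->
  \tr E = (\rank E)%:R.
Proof.
move=> EE; have : row_base E *m col_base E = 1%:M.
  apply: (row_full_inj (col_base_full E)); apply: (row_free_inj (row_base_free E)).
  by rewrite /= mulmx1 mulmx_base mulmxA mulmx_base -mulmxA mulmx_base.
move=> e; rewrite -{1}(mulmx_base E) mxtrace_mulC e mxtrace1.
by [].
Qed.

Lemma cfdot_neq0P : reflect
  (exists2 v : 'rV_(irr_degree (socle_of_Iirr i)), v != 0 &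
    forall h, h \in H -> v *m rG h = psi h *: v)
  ('['Res[H] 'chi_i, psi] != 0).
Proof.
rewrite cfdot_proj (idem_trace proj_mx_idem) pnatr_eq0 mxrank_eq0.
apply: (iffP idP) => [nz|[v nv hv]].
  have /matrix0Pn[p [q ne]] := nz; exists (row p proj_mx).
    by apply/rV0Pn; exists q; rewrite mxE.
  by move=> h Hh; rewrite -row_mul proj_mx_r //; apply/rowP => k; rewrite !mxE.
by apply: contraNneq nv => z; rewrite -(proj_mx_id hv) z mulmx0.
Qed.

Lemma cfdot_le1 :
  (forall u v : 'rV_(irr_degree (socle_of_Iirr i)),
     (forall h, h \in H -> u *m rG h = psi h *: u) ->
     (forall h, h \in H -> v *m rG h = psi h *: v) ->
     u != 0 -> exists c, v = c *: u) ->
  '['Res[H] 'chi_i, psi] <= 1.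
Proof.
move=> uniq; rewrite cfdot_proj (idem_trace proj_mx_idem).
have rowE p h : h \in H -> row p proj_mx *m rG h = psi h *: row p proj_mx.
  by move=> Hh; rewrite -row_mul proj_mx_r //; apply/rowP => k; rewrite !mxE.
rewrite -[1]/(1%:R) ler_nat; have [->|nz] := eqVneq proj_mx 0; first by rewrite mxrank0.
have /matrix0Pn[p [q ne]] := nz.
have n0 : row p proj_mx != 0 by apply/rV0Pn; exists q; rewrite mxE.
apply: leq_trans (rank_leq_row (row p proj_mx)); apply: mxrankS.
apply/row_subP => k; apply/sub_rVP.
exact: (uniq _ _ (rowE p) (rowE k) n0).
Qed.

End Projectors.


Lemma Chi_span (gT : finGroupType) (G : {group gT}) (i : Iirr G)
    (X : 'M_(irr_degree (socle_of_Iirr i))) :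
  exists c, X = \sum_(g in G) c g *: 'Chi_i g.
Proof.
have /mx_abs_irrP[_ [c hc]] : mx_absolutely_irreducible 'Chi_i.
  exact/groupC/socle_irr.
by exists (c^~ X); exact: hc.
Qed.

Section CharClass.
Variables (gT : finGroupType) (H : {group gT}) (f : gT -> algC).
Hypothesis fM : {in H &, forall g h, f (g * h)%g = f g * f h}.
Hypothesis f1 : f 1%g = 1.

Lemma exists_char_cfun : exists psi : 'CF(H), forall g, g \in H -> psi g = f g.
Proof.
pose f0 g := if g \in H then f g else 0.
have cf : is_class_fun <<H>>%g (finfun f0).
  rewrite genGid; apply: intro_class_fun => [x y Hx Hy | x nx]; last by rewrite /f0 (negPf nx).
  rewrite /f0 groupJ // Hx !fM ?groupM ?groupV //.
  by rewrite mulrCA -fM ?groupV // mulVg f1 mulr1.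
exists (Cfun 0 cf) => g Hg.
by rewrite cfunElock /f0 Hg.
Qed.
End CharClass.

(** * Congruences and roots of one-units *)

Section Congruence.
Variables (R : comNzRingType) (t : R).
Implicit Types x y : R.

Definition tcong x y := exists r, x = y + t * r.

Lemma tcong_refl x : tcong x x.
Proof. by exists 0; rewrite mulr0 addr0. Qed.

Lemma tcongD x y x' y' : tcong x y -> tcong x' y' -> tcong (x + x') (y + y').
Proof. by move=> [r ->] [s ->]; exists (r + s); ring. Qed.

Lemma tcongM x y x' y' : tcong x y -> tcong x' y' -> tcong (x * x') (y * y').
Proof. by move=> [r ->] [s ->]; exists (r * y' + y * s + t * r * s); ring. Qed.

Lemma tcongX x y k : tcong x y -> tcong (x ^+ k) (y ^+ k).
Proof.
move=> h; elim: k => [|k IHk]; first exact: tcong_refl.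
by rewrite !exprS; apply: tcongM.
Qed.

Lemma tcong_det m (A B : 'M[R]_m) : (forall i j, tcong (A i j) (B i j)) ->
  tcong (\det A) (\det B).
Proof.
move=> h; rewrite /determinant; apply: (big_ind2 tcong).
- exact: tcong_refl.
- by move=> *; apply: tcongD.
move=> s _; apply: tcongM; first exact: tcong_refl.
apply: (big_ind2 tcong) => [||j _]; [exact: tcong_refl| |exact: h].
by move=> *; apply: tcongM.
Qed.

End Congruence.

Section OneUnits.
Variables (R : finComUnitRingType) (l a b : nat) (w : R) (phi : R -> algC).
Hypothesis S : setting l a b w phi.
Variable p : nat.
Hypothesis hp : resid_char R p.

(** Raising [1 + x] to the power [p] multiplies [x] by a sum of [p] powers of [1 + x], which is
    congruent to [p], hence to 0, modulo [w]; each step gains a factor [w]. *)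
Lemma one_unit_pX k r : tcong (w ^+ k.+1) ((1 + w * r) ^+ (p ^ k)) 1.
Proof.
elim: k => [|k [s IHk]]; first by exists r; rewrite expn0 !expr1.
rewrite expnSr exprM IHk; set x := w ^+ k.+1 * s.
have [c pc] := nunit_w S (proj2 hp).
have [d dE] : tcong w (\sum_(i < p) (1 + x) ^+ (p.-1 - i) * 1 ^+ i) (w * c).
  rewrite -pc -(mulr_natr 1) mul1r.
  have -> : p%:R = \sum_(i < p) 1 :> R by rewrite sumr_const card_ord.
  apply: (big_ind2 (tcong w)) => [||i _]; first exact: tcong_refl.
    by move=> *; apply: tcongD.
  have : tcong w ((1 + x) ^+ (p.-1 - i)) (1 ^+ (p.-1 - i)).
    by apply: tcongX; exists (w ^+ k * s); rewrite /x exprS mulrA.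
  by rewrite !expr1n mulr1.
have := subrXX (1 + x) 1 p; rewrite expr1n addrAC subrr add0r dE => e.
exists (s * (c + d)); rewrite -[LHS](subrK 1) e addrC /x.
by rewrite [w ^+ k.+2]exprSr; ring.
Qed.

(** All one-units have order dividing [N = p ^ l], which is prime to [n]; so [e] is an inverse of
    [- n] modulo [N], the same for all [r]. *)
Lemma one_unit_root n : ~~ (p %| n)%N -> (0 < n)%N ->
  exists e, forall r, ((1 + w * r) ^+ e) ^+ n * (1 + w * r) = 1.
Proof.
case: hp => pp _ pn n0; pose N := (p ^ l)%N.
have N0 : (0 < N)%N by rewrite expn_gt0 prime_gt0.
have cop : coprime n N by rewrite coprimeXr // coprime_sym prime_coprime.
have [[u v] /= uv] := coprimeP N n0 cop.
exists (u * N.-1)%N => r; set d := 1 + w * r.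
have dN : d ^+ N = 1.
  have [s ->] := one_unit_pX l r.
  by rewrite exprS (w_l S) mulr0 mul0r addr0.
have eN : ((u * N.-1) * n + 1 = N * (1 + v * N.-1))%N by nia.
by rewrite -exprM -exprSr -addn1 eN exprM dN expr1n.
Qed.

Lemma natr_unit n : ~~ (p %| n)%N -> (0 < n)%N -> (n%:R : R) \is a GRing.unit.
Proof.
case: hp => pp pw pn n0; have cop : coprime n p.
  by rewrite coprime_sym prime_coprime.
have [[u v] /= uv] := coprimeP p n0 cop.
apply/negPn/negP => /(nunit_w S)[s ns]; have [c pc] := nunit_w S pw.
case/negP: (w_nunit S); apply/unitrP; exists (s * u%:R - c * v%:R).
have : (u * n)%:R = 1 + (v * p)%:R :> R by rewrite -(natrD _ 1); congr _%:R; lia.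
rewrite !natrM ns pc => e.
have e1 : w * (s * u%:R - c * v%:R) = 1.
  by apply: (addIr (v%:R * (w * c))); rewrite -e; ring.
by rewrite mulrC e1.
Qed.

End OneUnits.

(** * Extending an irreducible representation from SL_n *)

Section Extension.
Variables (R : finComUnitRingType) (l a b : nat) (w : R) (phi : R -> algC).
Hypothesis S : setting l a b w phi.
Variables (p m : nat).
Hypothesis hp : resid_char R p.
Variable isSL : bool.
Hypothesis hSL : isSL -> ~~ (p %| m.+1)%N.
Variable i : Iirr (Ggrp m.+1 R isSL).
Local Notation M := 'M[R]_m.+1.
Local Notation GL := {'GL_m.+1[R]}.
Local Notation level := (@level R l w m).
Local Notation d := (irr_degree (socle_of_Iirr i)).
Local Notation rG := ('Chi_i : mx_representation algC (Ggrp m.+1 R isSL) d).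

Let l0 : (0 < l)%N. Proof. by rewrite (l_split S) addn_gt0 (a_gt0 S). Qed.

Definition GLof (A : M) : GL := insubd (1%g : GL) A.

Lemma GLofK A : A \is a GRing.unit -> GLval (GLof A) = A :> M.
Proof. by move=> uA; apply: (@insubdK _ _ _ (1%g : GL)). Qed.

Lemma GLvalK (g : GL) : GLof (GLval g) = g.
Proof. exact: valKd. Qed.

Lemma GLofM A B : A \is a GRing.unit -> B \is a GRing.unit ->
  GLof (A * B) = (GLof A * GLof B)%g.
Proof.
move=> uA uB; apply: val_inj; apply: etrans (GLofK _) _; first by rewrite unitrMr.
by rewrite -[RHS]/(GLval (GLof A) * GLval (GLof B)) !GLofK.
Qed.

Lemma mem_Ggrp (g : GL) : (g \in Ggrp m.+1 R isSL) = (isSL ==> (\det (GLval g) == 1)).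
Proof. by rewrite /Ggrp; case: isSL; rewrite !inE. Qed.

(* For [SL] the representation is extended to matrices with determinant in
   [1 + w R] by letting scalars in [1 + w R] act trivially, which is possible
   because [n] is prime to [p]. *)
Lemma exists_matrep : exists (G : pred M) (rho : M -> 'M[algC]_d),
  [/\ matrep l w G rho,
    forall g, g \in Ggrp m.+1 R isSL -> rho (GLval g) = rG g,
    isSL -> forall r, rho (1 + w * r)%:M = 1%:M
  & forall Y, level l.-1 Y -> exists g,
      [/\ g \in Kgrp m.+1 isSL w l.-1, rho (1 + Y) = rG g
        & forall x, (isSL -> \tr x = 0) ->
            \tr (x * (GLval g - 1)) = \tr (x * Y)]].
Proof.
have [e he] : exists e, isSL -> forall r,
    ((1 + w * r) ^+ e) ^+ m.+1 * (1 + w * r) = 1.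
  case: isSL hSL => [/(_ isT) pn|_]; last by exists 0%N.
  by have [e he] := one_unit_root S hp pn (ltn0Sn m); exists e.
pose ue (x : R) := [exists r, x == 1 + w * r].
have ueP x : reflect (tcong w x 1) (ue x).
  by apply: (iffP existsP) => -[r]; [move/eqP; exists r | exists r; apply/eqP].
pose G (A : M) := (A \is a GRing.unit) && (isSL ==> ue (\det A)).
(* By the choice of [e], [s A *: A] has determinant 1 for [A] in [G] in the SL case; [rho] lets [A]
   act as this matrix. *)
pose s (A : M) : R := if isSL then \det A ^+ e else 1.
pose pr A := s A *: A.
have sM A B : s (A * B) = s A * s B.
  by rewrite /s; case: isSL; rewrite ?mulr1 // det_mulmx exprMn.
have prM A B : pr (A * B) = pr A * pr B.
  by rewrite /pr sM -scalerAl -scalerAr scalerA.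
have s1 : s 1 = 1 by rewrite /s det1 expr1n; case: isSL.
have pr_det A : \det A = 1 -> pr A = A.
  by rewrite /pr /s => ->; rewrite expr1n; case: isSL; rewrite scale1r.
have ws r : 1 + w * r \is a GRing.unit.
  apply/negPn/negP => /(nunit_w S)[c hc]; case/negP: (w_nunit S).
  apply/unitrP; exists (c - r).
  by rewrite mulrC mulrBr -hc addrK.
have unit_pr A : G A -> pr A \is a GRing.unit.
  case/andP=> uA hA; have us : s A \is a GRing.unit.
    rewrite /s; case: isSL hA; rewrite ?unitr1 //= => /ueP[r ->].
    exact/unitrX/ws.
  rewrite -[_ \is a _]/(pr A \in unitmx) unitmxE detZ unitrM unitrX //=.
have mem_pr A : G A -> GLof (pr A) \in Ggrp m.+1 R isSL.
  move=> GA; rewrite mem_Ggrp GLofK ?unit_pr //; apply/implyP => sl.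
  case/andP: GA => _; rewrite sl /= => /ueP[r hr].
  by rewrite detZ /s sl hr he.
pose rho A := rG (GLof (pr A)).
have GM A B : G A -> G B -> G (A * B).
  move=> /andP[uA hA] /andP[uB hB]; rewrite /G unitrMr // uB det_mulmx.
  apply/implyP => sl; rewrite sl /= in hA hB.
  by apply/ueP; rewrite -[1]mulr1; apply: tcongM; apply/ueP.
have GSL A : \det A = 1 -> G A.
  move=> dA; rewrite /G -[_ \is a _]/(A \in unitmx) unitmxE dA unitr1 /=.
  by apply/implyP => _; apply/ueP/tcong_refl.
have rhoM A B : G A -> G B -> rho (A * B) = rho A *m rho B.
  by move=> GA GB; rewrite /rho prM GLofM ?unit_pr // repr_mxM ?mem_pr.
have rhoG g : g \in Ggrp m.+1 R isSL -> rho (GLval g) = rG g.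
  rewrite mem_Ggrp /rho => hg; congr (rG _); rewrite -[RHS]GLvalK; congr GLof.
  by rewrite /pr /s; case: isSL hg => /= [/eqP ->|_]; rewrite ?expr1n scale1r.
have detK k Y : (0 < k <= l)%N -> level k Y -> tcong (w ^+ k) (\det (1 + Y)) 1.
  case/andP=> k0 kl /(levelP S kl)[Z ->].
  suff: tcong (w ^+ k) (\det (1 + w ^+ k *: Z)) (\det (1 : M)) by rewrite det1.
  by apply: tcong_det => q j; exists (Z q j); rewrite !mxE.
have tcong_w k x : (0 < k)%N -> tcong (w ^+ k) x 1 -> tcong w x 1.
  case: k => // k _ [r ->]; exists (w ^+ k * r); by rewrite exprS mulrA.
have GK A : level 1 (A - 1) -> G A.
  move=> h; have AE : A = 1 + (A - 1) by rewrite addrC subrK.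
  rewrite /G {1}AE (level1_unit S) //=; apply/implyP => _; apply/ueP.
  by rewrite AE -(expr1 w); apply: detK.
exists G, rho; split=> //.
- split=> //.
  + by move=> A /andP[].
  + move=> A /andP[uA hA]; rewrite /G unitrV uA det_inv /=; apply/implyP => sl.
    rewrite sl /= in hA; have /ueP[r hr] := hA; apply/ueP.
    exists (- r * (\det A)^-1); have ud : \det A \is a GRing.unit by rewrite hr.
    by apply: (mulIr ud); rewrite mulVr // mulrDl mul1r -!mulrA mulVr // mulr1 hr; ring.
  + by rewrite /rho pr_det ?det1 // -[1]/(GLval (1%g : GL)) GLvalK repr_mx1.
  move=> X; have [c hc] := Chi_span X.
  exists (fun A => if GLof A \in Ggrp m.+1 R isSL then c (GLof A) else 0).
  rewrite {1}hc [RHS](reindex_onto (fun g : GL => GLval g : M) GLof) /=; last first.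
    by move=> A /andP[uA _]; apply: GLofK.
  rewrite [LHS]big_mkcond [RHS]big_mkcond /=; apply: eq_bigr => g _.
  rewrite GLvalK eqxx andbT; case: ifPn => hg; last by rewrite scale0r if_same.
  rewrite rhoG // ifT // /G (GL_unit g) /=; apply/implyP => sl.
  move: hg; rewrite mem_Ggrp sl => /eqP ->; exact/ueP/tcong_refl.
- move=> sl r; rewrite /rho; have -> : pr (1 + w * r)%:M = 1.
    rewrite /pr /s sl det_scalar -mul_scalar_mx -scalar_mxM.
    by rewrite -exprM mulnC exprM he.
  by rewrite -[1]/(GLval (1%g : GL)) GLvalK repr_mx1.
move=> Y hY; have k1 : (0 < l.-1)%N.
  by have := a_gt0 S; have := le_a_b S; have := l_split S; lia.
have kl : (l.-1 <= l)%N by lia.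
have lY : level 1 Y by apply: level_le hY.
have GY : G (1 + Y) by apply: GK; rewrite addrC addKr.
have wY : w ^+ l.-1 *: Y = 0.
  have /eqP : level 1 Y by []; rewrite subn1.
  by [].
(* [s (1 + Y) *: (1 + Y)] differs from [1 + Y] by a scalar matrix in [w^(l - 1) M], invisible to a
   traceless [x]. *)
have [r sr] : tcong (w ^+ l.-1) (s (1 + Y)) 1.
  rewrite /s; case: isSL; last exact: tcong_refl.
  by rewrite -[X in tcong _ _ X](expr1n _ e); apply/tcongX/detK => //; rewrite k1.
exists (GLof (pr (1 + Y))); split=> //.
  rewrite inE mem_pr //= inE; apply/existsP.
  have [Z YZ] := levelP S kl hY; exists (r *: (1 + Y) + Z).
  rewrite GLofK ?unit_pr // /pr sr scalerDl scale1r [X in _ == _ + X]scalerDr -YZ scalerA.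
  by rewrite -addrA [X in _ + X]addrC.
move=> x tx; rewrite GLofK ?unit_pr // /pr.
have -> : s (1 + Y) *: (1 + Y) - 1 = (s (1 + Y) - 1) *: 1 + Y.
  have sY : s (1 + Y) *: Y = Y.
    by rewrite sr scalerDl scale1r mulrC -scalerA wY scaler0 addr0.
  by rewrite scalerDr sY scalerBl scale1r; mx_zmod.
rewrite mulrDr mxtraceD -scalerAr mulr1 mxtraceZ.
suff -> : (s (1 + Y) - 1) * \tr x = 0 by rewrite add0r.
rewrite /s; case: isSL tx => [->|_] //; first by rewrite mulr0.
by rewrite subrr mul0r.
Qed.
End Extension.


(** * Non-degenerate characters of [U] and Hessenberg matrices *)

Section Dictionary.
Variables (R : finComUnitRingType) (l a b : nat) (w : R) (phi : R -> algC).
Hypothesis S : setting l a b w phi.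
Variable m : nat.
Local Notation M := 'M[R]_m.+1.
Local Notation GL := {'GL_m.+1[R]}.
Local Notation level := (@level R l w m).
Local Notation U := (U_group m.+1 R).
Local Notation tr A := (\tr (A : M)).

Definition trphi (x : M) (g : GL) : algC := phi (tr (x * (GLval g - 1))).

Lemma U_supper (u : GL) : (u \in U) = supper (GLval u - 1 : M).
Proof.
rewrite inE; apply/idP/supperP => [/forallP h i j ij|h].
  have /forallP/(_ j)/andP[/implyP h1 /implyP h2] := h i.
  rewrite !mxE; move: ij; rewrite leq_eqVlt => /orP[/eqP/val_inj e|ji].
    by rewrite e in h2 *; rewrite (eqP (h2 (eqxx _))) eqxx subrr.
  by rewrite (eqP (h1 ji)) -val_eqE /= gtn_eqF ?subr0.
apply/forallP => i; apply/forallP => j.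
apply/andP; split; apply/implyP => ij.
  have := h i j (ltnW ij); rewrite !mxE -val_eqE /= gtn_eqF ?subr0 // => ->.
  by [].
have := h i j; rewrite (eqP ij) leqnn => /(_ isT); rewrite !mxE eqxx => /eqP.
by rewrite subr_eq0.
Qed.

Lemma trphi1 x : trphi x 1%g = 1.
Proof. by rewrite /trphi GL_1E subrr mulr0 mxtrace0 (phi_0 S). Qed.

Lemma trphiM x (g h : GL) :
  tr (x * ((GLval g - 1) * (GLval h - 1))) = 0 ->
  trphi x (g * h)%g = trphi x g * trphi x h.
Proof.
rewrite /trphi -(phi_D S) -mxtraceD -mulrDr => e; congr phi.
have -> : GLval (g * h)%g - 1 = (GLval g - 1) * (GLval h - 1) +
    (GLval g - 1 + (GLval h - 1)) :> M.
  rewrite -[GLval (g * h)%g]/(GLval g * GLval h : M) mulrBl !mulrBr mulr1 !mul1r.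
  by mx_zmod.
by rewrite (mulrDr x) mxtraceD e add0r.
Qed.

Lemma trphi_conj (H : {group GL}) x :
  {in H &, forall g h, trphi x (g * h)%g = trphi x g * trphi x h} ->
  {in H, forall g, (trphi x g)^* = trphi x g^-1%g}.
Proof.
move=> fM g Hg; rewrite {1}/trphi (phi_conj S) (phi_N S) -/(trphi x g).
have e : trphi x g * trphi x g^-1%g = 1 by rewrite -fM ?groupV // mulgV trphi1.
have nz : trphi x g != 0.
  by apply/eqP => z; move/eqP: e; rewrite z mul0r eq_sym oner_eq0.
by apply: (mulfI nz); rewrite mulfV // e.
Qed.

Lemma trphiM_U x : hess x ->
  {in U &, forall g h, trphi x (g * h)%g = trphi x g * trphi x h}.
Proof.
move=> hx g h; rewrite !U_supper => sg sh.
by apply: trphiM; apply: tr_hess.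
Qed.

Lemma trphi_U x u : hess x -> u \in U ->
  trphi x u = \prod_(i < m) phi (x (inord i.+1) (inord i) *
                GLval u (inord i) (inord i.+1)).
Proof.
rewrite U_supper => hx su; rewrite /trphi tr_hess_sub // (phi_sum S).
apply: eq_bigr => i _; congr (phi (_ * _)).
rewrite !mxE -val_eqE /= !inordK ?ltnS // 1?ltnW //.
by rewrite ltn_eqF // mulr0n subr0.
Qed.

Lemma nondeg_hess (theta : 'CF(U)) : nondeg_char l w theta ->
  exists2 x, hess x & forall u, u \in U -> theta u = trphi x u.
Proof.
case=> phis [hphis htheta].
have hc (i : 'I_m) : exists c, forall r, phis i r = phi (c * r).
  by apply: (additive_charE S); case: (hphis i).
have [c cE] := fin_all_exists hc.
have uc i : c i \is a GRing.unit.
  apply/(primitive_unit S); have [_ [r nr]] := hphis i.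
  by exists r; rewrite -cE.
(* [insub] views the column index in ['I_m]; the default 0 is never reached, because [i = j.+1]
   forces [j < m]. *)
pose x : M := \matrix_(i, j)
  if i == j.+1 :> nat then odflt 0 (omap c (insub (j : nat))) else 0.
have xE (i : 'I_m) : x (inord i.+1) (inord i) = c i.
  rewrite mxE !inordK ?ltnS // 1?ltnW // eqxx insubT //= => im.
  by congr c; apply: val_inj.
have hx : hess x.
  move=> i j ji; rewrite mxE; case: eqP => // e.
  have jm : (j < m)%N by rewrite -ltnS -e.
  by rewrite insubT /= uc.
exists x => // u Uu; rewrite trphi_U // htheta //.
by apply: eq_bigr => i _; rewrite cE xE.
Qed.

Lemma hess_nondeg x : hess x ->
  exists2 theta : 'CF(U), nondeg_char l w theta & forall u, u \in U -> theta u = trphi x u.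
Proof.
move=> hx; have [theta ht] := exists_char_cfun (trphiM_U hx) (trphi1 x).
exists theta => //.
exists (fun i r => phi (x (inord i.+1) (inord i) * r)); split=> [i|u Uu].
  split; first by split=> [|r s]; rewrite ?mulr0 ?(phi_0 S) // mulrDr (phi_D S).
  apply/(primitive_unit S).
  have i1 : (i.+1 < m.+1)%N by rewrite ltnS.
  have := hx (inord i.+1) (inord i); rewrite (inordK i1) inordK ?ltnSn ?eqxx.
    by apply.
  exact: ltnW.
by rewrite ht // trphi_U.
Qed.

End Dictionary.

(** * Regularity and Whittaker models of one irreducible character *)

Section Irreducible.
Variables (R : finComUnitRingType) (l a b : nat) (w : R) (phi : R -> algC).
Hypothesis S : setting l a b w phi.
Variables (p m : nat).
Hypothesis hp : resid_char R p.
Variable isSL : bool.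
Hypothesis hSL : isSL -> ~~ (p %| m.+1)%N.
Variable i : Iirr (Ggrp m.+1 R isSL).
Local Notation M := 'M[R]_m.+1.
Local Notation GL := {'GL_m.+1[R]}.
Local Notation level := (@level R l w m).
Local Notation d := (irr_degree (socle_of_Iirr i)).
Local Notation rG := ('Chi_i : mx_representation algC (Ggrp m.+1 R isSL) d).
Local Notation U := (U_group m.+1 R).
Local Notation K := (Kgrp m.+1 isSL w l.-1).
Local Notation trphi := (@trphi R phi m).
Local Notation tr A := (\tr (A : M)).

Lemma sUG : U \subset Ggrp m.+1 R isSL.
Proof.
apply/subsetP => u; rewrite U_supper mem_Ggrp => su; apply/implyP => _.
by rewrite -[GLval u : M](subrK 1) addrC (det_1supper su).
Qed.

Lemma sKG : K \subset Ggrp m.+1 R isSL.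
Proof. exact: subsetIl. Qed.

Lemma K_level (g : GL) : g \in K -> level l.-1 (GLval g - 1).
Proof.
rewrite inE => /andP[_]; rewrite inE => /existsP[y /eqP ->].
by rewrite addrC addKr (level_w S).
Qed.

Let l1 : (0 < l.-1)%N.
Proof. by have := a_gt0 S; have := le_a_b S; have := l_split S; lia. Qed.

Let bl1 : (b <= l.-1)%N.
Proof. by have := a_gt0 S; have := l_split S; lia. Qed.

Lemma trphiM_K x :
  {in K &, forall g h, trphi x (g * h)%g = trphi x g * trphi x h}.
Proof.
move=> g h /K_level hg /K_level hh; apply: (trphiM S).
by rewrite (levelM0 S _ hg hh) ?mulr0 ?mxtrace0 //; lia.
Qed.

Variables (G : pred M) (rho : M -> 'M[algC]_d).
Hypothesis rep : matrep l w G rho.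
Hypothesis rhoG : forall g, g \in Ggrp m.+1 R isSL -> rho (GLval g) = rG g.
Hypothesis rho_scalar : isSL -> forall r, rho (1 + w * r)%:M = 1%:M.
Hypothesis rho_K : forall Y, level l.-1 Y -> exists g,
  [/\ g \in K, rho (1 + Y) = rG g & forall x, (isSL -> tr x = 0) ->
        tr (x * (GLval g - 1)) = tr (x * Y)].
Local Notation eid := (@eid R l b w phi m d rho).
Local Notation whit := (@whit R l w phi m d rho).

Lemma whit_eigen x (v : 'rV[algC]_d) :
  (forall u, u \in U -> v *m rG u = trphi x u *: v) <-> whit 0 x v.
Proof.
split=> [h Y sY _|h u Uu].
  have uY : 1 + Y \is a GRing.unit by apply: (unit_1supper rep).
  have UY : GLof (1 + Y) \in U by rewrite U_supper GLofK // addrC addKr.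
  have := h _ UY; rewrite -rhoG ?(subsetP sUG) // /trphi GLofK //.
  by rewrite [1 + Y - 1]addrC addKr.
rewrite -rhoG ?(subsetP sUG) // -[GLval u : M](subrK 1) addrC.
by rewrite h ?(level_0 S) // -U_supper.
Qed.

(** Frobenius reciprocity turns the pairing into the multiplicity of [theta] in the restriction to
    [U], the dimension of the space of Whittaker vectors. *)
Lemma whittakerP x (theta : 'CF(U)) : hess x ->
  (forall u, u \in U -> theta u = trphi x u) ->
  (whittaker i theta <-> exists2 v, v != 0 & whit 0 x v) /\
  '['chi_i, 'Ind[Ggrp m.+1 R isSL] theta] <= 1.
Proof.
move=> hx ht; have tM := trphiM_U S hx.
have psiM : {in U &, forall g h, theta (g * h)%g = theta g * theta h}.
  by move=> g h Ug Uh; rewrite !ht ?groupM // tM.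
have psiC : {in U, forall g, (theta g)^* = theta g^-1%g}.
  by move=> g Ug; rewrite !ht ?groupV // (trphi_conj S tM).
have psi1 : theta 1%g = 1 by rewrite ht ?group1 // (trphi1 S).
have ev (v : 'rV[algC]_d) :
    (forall u, u \in U -> v *m rG u = theta u *: v) <-> whit 0 x v.
  rewrite -whit_eigen; split=> h u Uu; first by rewrite -ht // h.
  by rewrite ht // h.
rewrite /whittaker -cfdot_Res_l; split.
  split=> [/(cfdot_neq0P i sUG psiM psiC psi1)[v nv /ev wv]|[v nv /ev wv]].
    by exists v.
  by apply/(cfdot_neq0P i sUG psiM psiC psi1); exists v.
apply: (cfdot_le1 sUG psiM psiC psi1) => u v /ev wu /ev wv nu.
exact: (whit_unique S rep hx wu wv nu).
Qed.

(** For SL the scalars in [1 + w^b R] act trivially, which puts [\tr z] in [w^a R]. As [n] is a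
    unit, subtracting the scalar [\tr z / n] stays in the class modulo [w^a] and keeps the
    idempotent. *)
Lemma traceless_lift z : eid z != 0 ->
  exists x, [/\ isSL -> \tr x = 0, level 1 (z - x) & eid x != 0].
Proof.
move=> nz; have [sl|sl] : ~~ isSL \/ isSL by case: (isSL); [right | left].
  by exists z; split=> //; [rewrite (negPf sl) | rewrite subrr level0].
have b0 : (0 < b)%N by have := a_gt0 S; have := le_a_b S; lia.
have bl : l = (a + b)%N := l_split S.
have tz : w ^+ b * \tr z = 0.
  apply: (phi_nondeg S) => r; have bY : level b (w ^+ b * r)%:M.
    by rewrite -scalemx1 -scalerA (level_w S).
  have := eid_r S rep z bY.
  have -> : 1 + (w ^+ b * r)%:M = (1 + w * (w ^+ b.-1 * r))%:M :> M.
    by rewrite [RHS]raddfD /= mulrA -exprS prednK.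
  rewrite rho_scalar // mulmx1 => e.
  have : (phi (tr (z * (w ^+ b * r)%:M)) - 1) *: eid z = 0.
    by rewrite scalerBl scale1r -e subrr.
  move/eqP; rewrite scaler_eq0 (negPf nz) orbF subr_eq0 => /eqP <-.
  by rewrite -scalemx1 -scalerAr mulr1 mxtraceZ; congr phi; ring.
have [s ts] : exists s, \tr z = w ^+ a * s.
  by apply: (w_ann S); rewrite bl ?leq_addr // addKn.
have un := natr_unit S hp (hSL sl) (ltn0Sn m).
have az : level a (z - (z - ((m.+1%:R : R)^-1 * \tr z)%:M)).
  by rewrite opprB addrC subrK ts mulrCA -scalemx1 -scalerA (level_w S).
exists (z - ((m.+1%:R : R)^-1 * \tr z)%:M); split.
- move=> _; have trc (c : R) : \tr (c%:M : M) = m.+1%:R * c.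
    by rewrite mxtrace_scalar mulr_natl.
  by rewrite mxtraceBE trc mulrA mulrV // mul1r subrr.
- exact: (level_a1 S).
by rewrite -(eid_eq S rho az).
Qed.

Lemma eid_regular z v : @krylov m.+1 R z v \in unitmx -> eid z != 0 ->
  regular_irr l w phi i.
Proof.
move=> cz /traceless_lift[x [tx lzx nx]]; exists x; split=> //.
  by exists v; apply: (krylov_unit_level1 S lzx).
have [psi hpsi] := exists_char_cfun (@trphiM_K x) (trphi1 S x).
have tM := @trphiM_K x.
exists psi; split.
  move=> g y Kg gE; rewrite hpsi // /trphi gE addrC addKr.
  by rewrite -scalerAr mxtraceZ.
apply/(cfdot_neq0P i sKG).
- by move=> g h Kg Kh; rewrite !hpsi ?groupM // tM.
- by move=> g Kg; rewrite !hpsi ?groupV // (trphi_conj S tM).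
- by rewrite hpsi ?group1 // (trphi1 S).
have [j nj] := row_neq0 nx; exists (row j (eid x)) => // g Kg.
have bg : level b (GLval g - 1) by apply: level_le (K_level Kg).
rewrite -rhoG ?(subsetP sKG) // hpsi // /trphi.
have := eid_r S rep x bg; rewrite addrC subrK => e.
by rewrite -row_mul e; apply/rowP => k; rewrite !mxE.
Qed.

(** An eigenvector of [K] with character [phi_x] has a component at some [y] congruent to [x] modulo
    [w]. The same vector is cyclic for [y], and an element of SL_n conjugates [y] to Hessenberg
    form. *)
Lemma regular_eid : regular_irr l w phi i ->
  exists2 x, hess x & eid x != 0.
Proof.
case=> x [tx [v cx] [psi [psix]]].
have hpsi g : g \in K -> psi g = trphi x g.
  move=> Kg; have := Kg; rewrite inE => /andP[_]; rewrite inE => /existsP[y /eqP gE].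
  rewrite (psix _ _ Kg gE) /trphi gE addrC addKr.
  by rewrite -scalerAr mxtraceZ.
have tM := @trphiM_K x.
case/(cfdot_neq0P i sKG).
- by move=> g h Kg Kh; rewrite !hpsi ?groupM // tM.
- by move=> g Kg; rewrite !hpsi ?groupV // (trphi_conj S tM).
- by rewrite hpsi ?group1 // (trphi1 S).
move=> u nu hu; have [y ny] := eid_support S rep nu.
have lxy : level 1 (x - y).
  (* The characters of [x] and [y] are compared on [w^(l - 1) M]; [rho_K] trades [1 + Y] for an
     element of [K] with the same action and the same pairing with [x]. *)
  have -> : 1%N = (l - l.-1)%N by lia.
  apply: (levelMw S) => [|Y lY]; first by lia.
  have [g [Kg gE gt]] := rho_K lY.
  have bY : level b Y by apply: level_le lY.
  have : (phi (tr (x * Y)) - phi (tr (y * Y))) *: (u *m eid y) = 0.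
    rewrite scalerBl; apply/eqP; rewrite subr_eq0; apply/eqP.
    rewrite [RHS](scalemxAr (phi _) u) -(eid_l S rep y bY) mulmxA gE hu //.
    by rewrite hpsi // /trphi gt // (scalemxAl _ u).
  move/eqP; rewrite scaler_eq0 (negPf ny) orbF subr_eq0 => /eqP e.
  by rewrite mulrBl mxtraceBE (phi_D S) e -(phi_D S) subrr (phi_0 S).
have cy := krylov_unit_level1 S lxy cx.
have [g [ug dg hg]] := regular_hess cy.
exists (g^-1 * y * g) => //.
have Gg := G_SL rep dg; apply: contraNneq ny => z.
have := eid_conj S rep y Gg; rewrite z mulmx0 => e.
have -> : eid y = eid y *m rho g *m rho g^-1.
  by rewrite -mulmxA (rhoK rep) // mulmx1.
by rewrite e mul0mx mulmx0.
Qed.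

End Irreducible.

(** * The equivalence with regularity and the multiplicity bound *)

Lemma whittaker_regular (R : finComUnitRingType) (l a b m p : nat) (w : R)
    (isSL : bool) (phi : R -> algC) (i : Iirr (Ggrp m.+1 R isSL)) :
  setting l a b w phi -> resid_char R p -> (isSL -> ~~ (p %| m.+1)%N) ->
  ((exists theta : 'CF(U_group m.+1 R), nondeg_char l w theta /\ whittaker i theta)
     <-> regular_irr l w phi i) /\
  (forall theta : 'CF(U_group m.+1 R), nondeg_char l w theta ->
     '['chi_i, 'Ind[Ggrp m.+1 R isSL] theta] <= 1).
Proof.
move=> S hp hSL; have [G [rho [rep rhoG rho_sc rho_K]]] := exists_matrep S hp hSL i.
split; last first.
  move=> theta /(nondeg_hess S)[x hx ht].
  by have [_] := whittakerP S rep rhoG hx ht.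
split=> [[theta [/(nondeg_hess S)[x hx ht] wt]]|reg].
  have [[/(_ wt)[v nv wv] _] _] := whittakerP S rep rhoG hx ht.
  have [y ny] := eid_support S rep nv.
  have [z xz yz] := whit_support S rep wv ny.
  rewrite (eid_eq S rho yz) in ny.
  have nz : eid l b w phi rho z != 0 by apply: contraNneq ny => ->; rewrite mulmx0.
  have uz := krylov_hess_unit (samelow_hess xz hx).
  exact: (eid_regular S hp hSL rep rhoG rho_sc uz nz).
have [x hx nx] := regular_eid S hSL rep rho_K reg.
have [v nv wv] := whit_exists S rep hx nx.
have [theta nt ht] := hess_nondeg S hx; exists theta; split=> //.
have [[_ h] _] := whittakerP S rep rhoG hx ht.
by apply: h; exists v.
Qed.

Theorem theorem1p2 (R : finComUnitRingType) (l n p : nat) (w : R)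
    (isSL : bool) (phi : R -> algC) :
  (2 <= l)%N -> (0 < n)%N -> oell l w -> resid_char R p ->
  (isSL -> odd p && ~~ (p %| n)%N) ->
  additive_char phi -> primitive_addchar l w phi ->
  (forall i : Iirr (Ggrp n R isSL),
     (exists theta : 'CF(U_group n R), nondeg_char l w theta /\ whittaker i theta)
     <-> regular_irr l w phi i)
  /\
  (forall theta : 'CF(U_group n R), nondeg_char l w theta ->
     forall i : Iirr (Ggrp n R isSL),
       '['chi_i, 'Ind[Ggrp n R isSL] theta] <= 1).
Proof.
case: n => // m l2 _ Rw hp hSL phi_add phi_prim.
have S := oell_setting l2 Rw phi_add phi_prim.
have pm : isSL -> ~~ (p %| m.+1)%N by move=> /hSL/andP[].
split=> [i|theta nt i]; have [iff le1] := whittaker_regular i S hp pm => //.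
exact: le1.
Qed.
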